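(* Let $(Z,d_Z)$ be any nonempty complete separable metric space and $p\in[1,\infty)$. Then $\mathcal{M}_\sim^{Z,p}$, with the topology induced by the metric $\mathrm{GW}_p^Z$, is contractible.
   Context: A $(Z,p)$-network is a triple $(X,\omega_X,\mu_X)$ where $X$ is a Polish space, $\mu_X$ is a Borel probability measure on $X$, and $\omega_X:X\times X\to Z$ is measurable with $\|d_Z(\omega_X(\cdot,\cdot),z_0)\|_{L^p(\mu_X\otimes\mu_X)}<\infty$ for some (equivalently every) $z_0\in Z$. $\mathcal{C}(\mu_X,\mu_Y)$ is the set of probability measures on $X\times Y$ with marginals $\mu_X$ and $\mu_Y$. Define $$\mathrm{GW}_p^Z(X,Y)=\tfrac12\inf_{\pi\in\mathcal{C}(\mu_X,\mu_Y)}\big\|(x,y,x',y')\mapsto d_Z(\omega_X(x,x'),\omega_Y(y,y'))\big\|_{L^p(\pi\otimes\pi)}.$$ $(Z,p)$-networks $X$ and $Y$ are weakly isomorphic, $X\sim Y$, if there exist a $(Z,p)$-network $(W,\omega_W,\mu_W)$ and measurable maps $\phi_X:W\to X$, $\phi_Y:W\to Y$ with $(\phi_X)_*\mu_W=\mu_X$, $(\phi_Y)_*\mu_W=\mu_Y$ and $\omega_W(w,w')=\omega_X(\phi_X(w),\phi_X(w'))=\omega_Y(\phi_Y(w),\phi_Y(w'))$ for $\mu_W\otimes\mu_W$-almost every $(w,w')$. $\mathcal{M}_\sim^{Z,p}$ is the quotient of the collection of all $(Z,p)$-networks by $\sim$; $\mathrm{GW}_p^Z$ is a metric on it. *)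

(* Defs.v *)
From HB Require Import structures.
From mathcomp Require Import all_boot all_order all_algebra.
From mathcomp Require Import all_classical all_reals all_analysis.

Set Implicit Arguments.
Unset Strict Implicit.
Unset Printing Implicit Defensive.

Import Order.TTheory GRing.Theory Num.Theory.
Import numFieldNormedType.Exports.

Local Open Scope classical_set_scope.
Local Open Scope ring_scope.

(* [Complete] includes a base point, hence nonemptiness. *)
#[short(type="completeMetricType")]
HB.structure Definition CompleteMetric (R : numDomainType) :=
  {M of Metric R M & Complete M}.

Definition separable (T : topologicalType) :=
  exists2 D : set T, countable D & dense D.

Definition homeomorphic (S T : topologicalType) :=
  exists (f : S -> T) (g : T -> S),
    [/\ cancel f g, cancel g f, continuous f & continuous g].

Definition polish (R : realType) (T : topologicalType) :=
  exists2 M : completeMetricType R, separable M & homeomorphic T M.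

Definition contractible (R : realType) (T : topologicalType) :=
  exists (x0 : T) (H : T * R -> T),
    [/\ {within [set: T] `*` `[0, 1], continuous H},
        forall x, H (x, 0) = x &
        forall x, H (x, 1) = x0].

Notation borel T := (g_sigma_algebraType (@open T)).

(* A measure in the library is a function on all sets, with junk values outside
   the measurable ones: equality is required on measurable sets only. *)
Definition is_pushforward d d' (S : measurableType d) (T : measurableType d')
    (R : realType) (f : S -> T) (m : set S -> \bar R) (n : set T -> \bar R) :=
  forall A : set T, measurable A -> pushforward m f A = n A.

Section networks.
Context (R : realType).

(* The carrier and its topology are stored separately, instead of as one
   [ptopologicalType], for universe reasons: the type of all networks must be
   small enough to be itself the carrier of a topological space.  The topology
   is pointed because measurable types are; this is no restriction, as a space
   carrying a probability measure is nonempty. *)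
Record polish_space := PolishSpace {
  carrier :> Type ;
  carrier_topology : PointedTopological.axioms_ carrier ;
  carrier_polish : polish R (PointedTopological.Pack carrier_topology) }.

Definition topology_of (X : polish_space) : ptopologicalType :=
  PointedTopological.Pack (carrier_topology X).

Local Notation bor X := (borel (topology_of X)).

Context (Z : completeMetricType R) (p : R).

Record network := Network {
  space :> polish_space ;
  law : probability (bor space) R ;
  weight : space * space -> Z ;
  weight_measurable :
    measurable_fun [set: bor space * bor space]
      (weight : bor space * bor space -> borel Z) ;
  weight_Lp : exists z0 : Z,
    (Lnorm (law \x law) p%:E (fun u => (mdist (weight u) z0)%:E) < +oo)%E }.

Definition couplings (X Y : network) : set (probability (bor X * bor Y)%type R) :=
  [set pi | is_pushforward fst pi (law X) /\ is_pushforward snd pi (law Y)].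
Arguments couplings : clear implicits.

Definition GW (X Y : network) : \bar R :=
  (2^-1%:E * ereal_inf
    [set Lnorm (pi \x pi) p%:E
           (fun u : (bor X * bor Y) * (bor X * bor Y) =>
              (mdist (weight (u.1.1, u.2.1)) (weight (u.1.2, u.2.2)))%:E)
      | pi in couplings X Y])%E.

Definition weakly_isomorphic (X Y : network) :=
  exists (W : network) (phiX : W -> X) (phiY : W -> Y),
    [/\ measurable_fun [set: bor W] (phiX : bor W -> bor X),
        measurable_fun [set: bor W] (phiY : bor W -> bor Y),
        is_pushforward (phiX : bor W -> bor X) (law W) (law X),
        is_pushforward (phiY : bor W -> bor Y) (law W) (law Y) &
        {ae (law W \x law W)%E, forall w : bor W * bor W,
          weight w = weight (phiX w.1, phiX w.2) /\
          weight w = weight (phiY w.1, phiY w.2)}].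

Definition network_classes : Type :=
  {C : set network | exists X, C = [set Y | weakly_isomorphic X Y]}.

Definition representative (C : network_classes) : network :=
  sval (cid (svalP C)).

(* [GW] only depends on the weak isomorphism classes of its arguments, so the
   choice of representatives does not matter. *)
Definition GW_classes (C D : network_classes) : \bar R :=
  GW (representative C) (representative D).

Definition GW_open : set_system network_classes :=
  [set U | forall C, U C ->
    exists2 e : R, 0 < e & [set D | (GW_classes C D < e%:E)%E] `<=` U].

Lemma GW_openT : GW_open [set: network_classes].
Proof. by move=> C _; exists 1. Qed.

Lemma GW_openI : setI_closed GW_open.
Proof.
move=> U V oU oV C [UC VC].
have [e e0 eU] := oU C UC; have [e' e'0 eV] := oV C VC.
exists (Num.min e e'); first by rewrite lt_min e0 e'0.
move=> D /= CD; split.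
- by apply: eU; rewrite /= (lt_le_trans CD)// lee_fin ge_min lexx.
- by apply: eV; rewrite /= (lt_le_trans CD)// lee_fin ge_min lexx orbT.
Qed.

Lemma GW_open_bigcup (I : Type) (f : I -> set network_classes) :
  (forall i, GW_open (f i)) -> GW_open (\bigcup_i f i).
Proof.
move=> of_ C [i _ fiC]; have [e e0 ef] := of_ i C fiC.
by exists e => // D CD; exists i => //; exact: ef.
Qed.

HB.instance Definition _ := gen_eqMixin network_classes.
HB.instance Definition _ := gen_choiceMixin network_classes.
HB.instance Definition _ := isOpenTopological.Build network_classes
  GW_openT GW_openI GW_open_bigcup.

End networks.

(* Main.v *)
Require Import Defs.
From HB Require Import structures.
From mathcomp Require Import all_boot all_order all_algebra.
From mathcomp Require Import all_classical all_reals all_analysis.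
From mathcomp Require Import measurable_realfun lra.

Set Implicit Arguments.
Unset Strict Implicit.
Unset Printing Implicit Defensive.

Import Order.TTheory GRing.Theory Num.Theory.
Import numFieldNormedType.Exports.

Local Open Scope classical_set_scope.
Local Open Scope ring_scope.

(** The contraction puts a cone over every network. Fix a point [z] of [Z]. For
   [t] in [0, 1], let [X_t] be two disjoint copies of [X], the first of mass
   [1 - t] and the second of mass [t], with the weight of [X] between points of
   the first copy and the constant weight [z] everywhere else. Up to weak
   isomorphism [X_0] is [X], and [X_1] is the one-point network of weight [z].

   All the networks [X_t] are images of [X * [0, 1]] with the product of the law
   of [X] and the uniform law: [(x, u)] is sent to the first copy of [x] when
   [t <= u], and to the second one otherwise. Any pair of maps from one
   probability space that realizes the laws of two networks bounds their
   distance ([GW_le_realization]), which gives two estimates.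
   - A coupling of [X] and [Y], times the diagonal coupling of [0, 1], couples
     [X_t] and [Y_t] at no larger cost, so [GW X_t Y_t <= GW X Y]
     ([is_cone_le]).
   - The weights of [X_t] and [X_s], seen on [X * [0, 1]], differ only where
     one of the two parameters lies between [s] and [t], and there by at most
     the distance of the weight of [X] to [z], which is in [L^p]. By absolute
     continuity of the integral, [GW X_t X_s] tends to [0] as [s] tends to [t]
     ([is_cone_continuous]).

   Hence [(X, t) |-> X_t] is jointly continuous, provided that [GW] is compatible
   with weak isomorphism and that its balls are open. Both follow from the
   triangle inequality ([GW_triangle]), for which a coupling of [X] and [Y] has
   to be glued to a coupling of [Y] and [W]. The gluing is done only up to an
   arbitrarily small error. The weight of [Y] is approximated in [L^p] by a
   function of the cells of a finite measurable partition of [Y]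
   ([kernel_step_approximable]), because finite unions of rectangles are dense
   among the measurable subsets of [Y * Y] ([measurable_approximable]). The two
   couplings are then made conditionally independent given the cell
   ([exists_gluing]): the resulting law carries two copies of the point of [Y],
   which may differ but lie in the same cell, so that the approximate weights
   computed from either copy agree. *)

(** * The L^p seminorm *)

Section Lp_seminorm.
Context d (T : measurableType d) (R : realType).
Variables (mu : {measure set T -> \bar R}) (p : R).
Hypothesis p_ge1 : 1 <= p.
Implicit Types f g h : T -> R.

Local Notation N f := (Lnorm mu p%:E (EFin \o f)).
Let p_gt0 : 0 < p. Proof. exact: lt_le_trans p_ge1. Qed.

Lemma measurable_powR_norm f : measurable_fun [set: T] f ->
  measurable_fun [set: T] (fun x => (`|f x| `^ p)%:E : \bar R).
Proof.
move=> mf; apply/measurable_EFinP.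
apply: (@measurableT_comp _ _ _ _ _ _ (@powR R ^~ p)) => //.
exact: measurableT_comp.
Qed.

Lemma Lnorm_powRE f :
  N f = ((\int[mu]_x (`|f x| `^ p)%:E) `^ p^-1)%E.
Proof. by rewrite unlock. Qed.

Let integral_powR_ge0 f A : (0 <= \int[mu]_(x in A) (`|f x| `^ p)%:E)%E.
Proof. by apply: integral_ge0 => x _; rewrite lee_fin powR_ge0. Qed.

Lemma le_Lnorm f g : measurable_fun [set: T] f -> measurable_fun [set: T] g ->
  (forall x, `|f x| <= `|g x|) -> (N f <= N g)%E.
Proof.
move=> mf mg fg; rewrite !Lnorm_powRE.
apply: gt0_ler_poweR.
- by rewrite invr_ge0 ltW.
- by rewrite in_itv/= leey andbT integral_powR_ge0.
- by rewrite in_itv/= leey andbT integral_powR_ge0.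
apply: ge0_le_integral => //.
- exact: measurable_powR_norm.
- exact: measurable_powR_norm.
- move=> x _; rewrite lee_fin ge0_ler_powR ?nnegrE// ltW//.
Qed.

(** Minkowski's inequality, in the form in which it serves to add up
   pointwise estimates of distances. *)
Lemma Lnorm_triangle f g h : measurable_fun [set: T] f ->
  measurable_fun [set: T] g -> measurable_fun [set: T] h ->
  (forall x, 0 <= f x <= g x + h x) -> (N f <= N g + N h)%E.
Proof.
move=> mf mg mh fgh; apply: (@le_trans _ _ (N (g \+ h))); last first.
  exact: minkowski_EFin.
apply: le_Lnorm => //; first exact: measurable_funD.
by move=> x; have /andP[f0 fgh0] := fgh x; rewrite !ger0_norm// (le_trans f0).
Qed.

Lemma Lnorm_ae0 f : measurable_fun [set: T] f ->
  {ae mu, forall x, f x = 0} -> N f = 0%E.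
Proof.
move=> mf f0; rewrite Lnorm_powRE.
rewrite (ae_eq_integral (cst 0%E)) ?integral0//.
- by rewrite poweR0r// invr_eq0 gt_eqF.
- exact: measurable_powR_norm.
- apply: filterS f0 => x -> _ /=.
  by rewrite normr0 powR0// gt_eqF.
Qed.

Lemma Lnorm_lty_integrable f : measurable_fun [set: T] f -> (N f < +oo)%E ->
  mu.-integrable [set: T] (fun x => (`|f x| `^ p)%:E).
Proof.
move=> mf Nf; apply/integrableP; split; first exact: measurable_powR_norm.
under eq_integral do rewrite abse_EFin ger0_norm ?powR_ge0//.
have := poweR_lty p Nf; rewrite powR_Lnorm ?gt_eqF//.
Qed.

(** Absolute continuity of the integral, applied to [`|f| `^ p]. *)
Lemma Lnorm_indic_small f (e : R) : measurable_fun [set: T] f ->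
  (N f < +oo)%E -> 0 < e ->
  exists2 r : R, 0 < r & forall A, measurable A -> (mu A < r%:E)%E ->
    (N (fun x => \1_A x * f x)%R <= e%:E)%E.
Proof.
move=> mf Nf e0; have intf := Lnorm_lty_integrable mf Nf.
have ep0 : 0 < e `^ p by exact: powR_gt0.
have [r [r0 rP]] := integral_normr_continuous intf ep0.
exists r => // A mA muA; have {rP} := rP A mA muA.
have intA : mu.-integrable A (fun x => (`|f x| `^ p)%:E).
  by apply: integrableS intf.
rewrite -lte_fin /Rintegral fineK; last first.
  under eq_integral do rewrite (ger0_norm (powR_ge0 _ _)).
  exact: integrable_fin_num.
under eq_integral do rewrite (ger0_norm (powR_ge0 _ _)).
move=> /ltW H; rewrite Lnorm_powRE.
rewrite (_ : \int[mu]_x _ = \int[mu]_(x in A) (`|f x| `^ p)%:E)%E.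
  rewrite -[leRHS](_ : ((e `^ p)%:E `^ p^-1)%E = _); last first.
    by rewrite poweR_EFin -powRrM mulfV ?gt_eqF// powRr1 ?ltW.
  apply: gt0_ler_poweR => //.
  - by rewrite invr_ge0 ltW.
  - by rewrite in_itv/= leey andbT integral_powR_ge0.
  - by rewrite in_itv/= leey andbT lee_fin ltW.
rewrite [RHS]integral_mkcond/=; apply: eq_integral => x _.
rewrite /patch indicE; case: ifPn => xA.
  by rewrite mul1r.
by rewrite mul0r normr0 powR0// gt_eqF.
Qed.

Lemma Lnorm_cst_ge0 (c : R) : mu [set: T] = 1%E -> 0 <= c ->
  N (fun=> c) = c%:E.
Proof.
move=> mu1 c0; rewrite Lnorm_powRE.
rewrite integral_cst//= mu1 mule1 poweR_EFin -powRrM mulfV ?gt_eqF//.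
by rewrite powRr1 ger0_norm.
Qed.

End Lp_seminorm.

(** * Image measures and products *)

Section pushforward_facts.
Context d d' (S : measurableType d) (T : measurableType d') (R : realType).

Lemma is_pushforward_ge0_integral (f : S -> T) (m : {measure set S -> \bar R})
    (n : {measure set T -> \bar R}) (F : T -> \bar R) :
  measurable_fun [set: S] f -> is_pushforward f m n ->
  measurable_fun [set: T] F -> (forall y, 0 <= F y)%E ->
  (\int[n]_y F y = \int[m]_x F (f x))%E.
Proof.
move=> mf fmn mF F0.
pose f' : {mfun S >-> T} := HB.pack f (isMeasurableFun.Build _ _ _ _ _ mf).
rewrite (@eq_measure_integral _ _ _ [set: T] (pushforward m f')).
  by rewrite ge0_integral_pushforward.
by move=> A mA _; rewrite -fmn.
Qed.

End pushforward_facts.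

Section pushforward_product.
Context d1 d2 d1' d2' (S1 : measurableType d1) (S2 : measurableType d2)
  (T1 : measurableType d1') (T2 : measurableType d2') (R : realType).
Variables (f : S1 -> T1) (g : S2 -> T2).
Hypotheses (mf : measurable_fun [set: S1] f) (mg : measurable_fun [set: S2] g).

Definition pair_map (u : S1 * S2) : T1 * T2 := (f u.1, g u.2).

Lemma measurable_pair_map : measurable_fun [set: S1 * S2] pair_map.
Proof. by apply: measurable_fun_pair; apply: measurableT_comp. Qed.

Variables (P1 : probability S1 R) (P2 : probability S2 R).
Variables (Q1 : probability T1 R) (Q2 : probability T2 R).
Hypotheses (fPQ : is_pushforward f P1 Q1) (gPQ : is_pushforward g P2 Q2).

Lemma is_pushforward_product :
  is_pushforward pair_map (P1 \x P2)%E (Q1 \x Q2)%E.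
Proof.
pose F : {mfun (S1 * S2)%type >-> (T1 * T2)%type} :=
  HB.pack pair_map (isMeasurableFun.Build _ _ _ _ _ measurable_pair_map).
move=> A mA; apply/esym.
apply: (@product_measure_unique _ _ _ _ _ Q1 Q2
  (pushforward (P1 \x P2)%E F)) => //.
move=> B C mB mC.
transitivity (P1 (f @^-1` B) * P2 (g @^-1` C))%E.
  apply: product_measure1E.
  - by rewrite -[_ @^-1` _]setTI; exact: mf.
  - by rewrite -[_ @^-1` _]setTI; exact: mg.
by congr (_ * _)%E; [exact: fPQ|exact: gPQ].
Qed.

End pushforward_product.

Lemma Lnorm_is_pushforward d d' (S : measurableType d) (T : measurableType d')
    (R : realType) (f : S -> T) (P : probability S R) (Q : probability T R)
    (p : R) (F : T * T -> R) :
  measurable_fun [set: S] f -> is_pushforward f P Q ->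
  measurable_fun [set: T * T] F ->
  Lnorm (Q \x Q)%E p%:E (EFin \o F) =
  Lnorm (P \x P)%E p%:E (EFin \o (F \o pair_map f f)).
Proof.
move=> mf fPQ mF; rewrite !Lnorm_powRE; congr (_ `^ _)%E.
apply: (@is_pushforward_ge0_integral _ _ _ _ _ (pair_map f f)
  (P \x P)%E (Q \x Q)%E (fun y => (`|F y| `^ p)%:E)).
- exact: measurable_pair_map.
- exact: is_pushforward_product.
- exact: measurable_powR_norm.
- by move=> y; rewrite lee_fin powR_ge0.
Qed.

(** * Kernels with values in a separable metric space *)

Notation bor X := (borel (topology_of X)).

Lemma open_metric_ball (R : realFieldType) (M : metricType R) (x : M) (r : R) :
  open (ball x r).
Proof.
rewrite openE/= => y; rewrite ballEmdist/= => xyr; rewrite /interior -nbhs_ballE.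
exists (r - mdist x y) => /=; first by rewrite subr_gt0.
move=> z; rewrite !ballEmdist/= => yz.
by rewrite (le_lt_trans (metric_triangle _ y _))// addrC -ltrBrDr.
Qed.

Section distance_measurable.
Context (R : realType) (Z : completeMetricType R) (separable_Z : separable Z).

Lemma dense_sequence : exists z_ : nat -> Z,
  forall (z : Z) (e : R), 0 < e -> exists n, mdist z (z_ n) < e.
Proof.
have [D cD dD] := separable_Z.
have D0 : D !=set0.
  have [z [_ Dz]] := dD [set: Z] (ex_intro _ point I) openT.
  by exists z.
have [z_ z_D] : exists z_ : nat -> Z, D = range z_.
  case/pfcard_geP : cD => [D_eq0|/unsquash z_].
    by move: D0; rewrite D_eq0 => -[].
  by exists z_; rewrite image_eq.
exists z_ => z e e0.
have [y [zy]] := dD (ball z e)^° (ex_intro _ z (nbhsx_ballx z e e0))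
  (open_interior _).
rewrite z_D => -[n _ nE]; exists n; rewrite nE.
by have := interior_subset zy; rewrite ballEmdist.
Qed.

(** Separability matters here: the open set [d(x, y) < r] is a countable union of
   products of balls, hence belongs to the product of the Borel sigma-algebras,
   which may be smaller than the Borel sigma-algebra of the product. *)
Lemma measurable_mdist : measurable_fun [set: borel Z * borel Z]
  (fun u : borel Z * borel Z => mdist (u.1 : Z) (u.2 : Z)).
Proof.
have [z_ z_dense] := dense_sequence.
move=> mT; apply: (measurability _ (RGenInftyO.measurableE R)) => //.
move=> _ [_ [r ->] <-].
rewrite setTI.
have -> : (fun u : borel Z * borel Z => mdist (u.1 : Z) (u.2 : Z))
      @^-1` `]-oo, r[ =
    \bigcup_n \bigcup_(q : rat) ((ball (z_ n) (ratr q) : set (borel Z)) `*`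
                                 (ball (z_ n) (r - ratr q) : set (borel Z))).
  apply/seteqP; split => [[x y]/=|[x y] [n _ [q _ []]]]/=; last first.
    rewrite !ballEmdist/= in_itv/= => nx ny.
    rewrite (le_lt_trans (metric_triangle _ (z_ n) _))//.
    by rewrite (metric_sym x) -(subrKC (ratr q) r) ltrD.
  rewrite in_itv/= => xyr.
  have e0 : 0 < (r - mdist x y) / 2 by rewrite divr_gt0// subr_gt0.
  have [n xn] := z_dense x _ e0.
  have yn : mdist (z_ n) y < r - mdist x (z_ n).
    rewrite (le_lt_trans (metric_triangle _ x _))// metric_sym.
    by move: xn; lra.
  have xny : mdist x (z_ n) < r - mdist (z_ n) y.
    by rewrite ltrBrDr addrC -ltrBrDr.
  have [q] := rat_in_itvoo xny.
  rewrite in_itv/= => /andP[xq qy].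
  exists n => //; exists q => //; split; rewrite ballEmdist/=.
    by rewrite metric_sym.
  by rewrite ltrBrDr addrC -ltrBrDr.
have openM (c : Z) (s : R) : measurable (ball c s : set (borel Z)).
  by apply: sub_sigma_algebra; exact: open_metric_ball.
apply: bigcup_measurable => n _; apply: bigcupT_measurable_rat => q.
exact: measurableX.
Qed.

Lemma measurable_fun_mdist d (T : measurableType d) (f g : T -> Z) :
  measurable_fun [set: T] (f : T -> borel Z) ->
  measurable_fun [set: T] (g : T -> borel Z) ->
  measurable_fun [set: T] (fun x => mdist (f x) (g x)).
Proof.
move=> mf mg.
exact: (measurableT_comp measurable_mdist (measurable_fun_pair mf mg)).
Qed.

End distance_measurable.

Definition pullback (S T U : Type) (f : S -> T) (v : T * T -> U) (u : S * S) : U :=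
  v (f u.1, f u.2).

(** The [L^p] distance between two kernels on a probability space; the cost of a
   coupling is the distance between the two weights pulled back to it. *)
Definition kernel_dist d (T : measurableType d) (R : realType)
    (Z : completeMetricType R) (P : probability T R) (p : R)
    (v w : T * T -> Z) : \bar R :=
  Lnorm (P \x P)%E p%:E (EFin \o (fun u => mdist (v u) (w u))).

Notation measurable_kernel Z v :=
  (measurable_fun [set: _ * _] (v : _ * _ -> borel Z)).

Section kernel_dist.
Context (R : realType) (Z : completeMetricType R) (p : R).
Hypotheses (separable_Z : separable Z) (p_ge1 : 1 <= p).
Context d (T : measurableType d) (P : probability T R).
Implicit Types v w x : T * T -> Z.

Lemma kernel_dist_triangle w v x : measurable_kernel Z v ->
  measurable_kernel Z w -> measurable_kernel Z x ->
  (kernel_dist P p v x <= kernel_dist P p v w + kernel_dist P p w x)%E.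
Proof.
move=> mv mw mx; apply: Lnorm_triangle => //;
  do ?exact: (measurable_fun_mdist separable_Z).
by move=> u; rewrite mdist_ge0 metric_triangle.
Qed.

Lemma kernel_dist_ge0 v w : (0 <= kernel_dist P p v w)%E.
Proof. exact: Lnorm_ge0. Qed.

Lemma le_kernel_dist v w v' w' : measurable_kernel Z v ->
  measurable_kernel Z w -> measurable_kernel Z v' -> measurable_kernel Z w' ->
  (forall u, mdist (v u) (w u) <= mdist (v' u) (w' u)) ->
  (kernel_dist P p v w <= kernel_dist P p v' w')%E.
Proof.
move=> mv mw mv' mw' H; apply: le_Lnorm => //.
- exact: (measurable_fun_mdist separable_Z).
- exact: (measurable_fun_mdist separable_Z).
- by move=> u; rewrite !ger0_norm ?mdist_ge0.
Qed.

Lemma kernel_dist_sym v w : kernel_dist P p v w = kernel_dist P p w v.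
Proof.
by congr Lnorm; apply/funext => u /=; rewrite metric_sym.
Qed.

Lemma kernel_dist_ae0 v w : measurable_kernel Z v -> measurable_kernel Z w ->
  {ae (P \x P)%E, forall u, v u = w u} -> kernel_dist P p v w = 0%E.
Proof.
move=> mv mw vw; apply: (Lnorm_ae0 p_ge1).
  exact: (measurable_fun_mdist separable_Z).
by apply: filterS vw => u ->; rewrite mdistxx.
Qed.

Lemma kernel_dist_cst (y z : Z) :
  kernel_dist P p (fun=> y) (fun=> z) = (mdist y z)%:E.
Proof.
by apply: (Lnorm_cst_ge0 p_ge1); [exact: probability_setT|exact: mdist_ge0].
Qed.

Context d' (S : measurableType d') (Q : probability S R) (f : T -> S).
Hypotheses (mf : measurable_fun [set: T] f) (fPQ : is_pushforward f P Q).

Lemma measurable_pullback (v : S * S -> Z) : measurable_kernel Z v ->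
  measurable_kernel Z (pullback f v).
Proof. by move=> mv; exact: (measurableT_comp mv (measurable_pair_map mf mf)). Qed.

Lemma kernel_dist_pushforward (v w : S * S -> Z) : measurable_kernel Z v ->
  measurable_kernel Z w ->
  kernel_dist Q p v w = kernel_dist P p (pullback f v) (pullback f w).
Proof.
move=> mv mw; apply: Lnorm_is_pushforward => //.
exact: (measurable_fun_mdist separable_Z).
Qed.

End kernel_dist.

(** * Upper bounds on the Gromov-Wasserstein distance *)

Section realizations.
Context (R : realType) (Z : completeMetricType R) (p : R).
Hypotheses (separable_Z : separable Z) (p_ge1 : 1 <= p).
Implicit Types X Y : network Z p.

Definition kernel X : bor X * bor X -> Z := @weight _ _ _ X.
Arguments kernel : clear implicits.

Lemma measurable_kernel_network X : measurable_kernel Z (kernel X).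
Proof. exact: weight_measurable. Qed.

(** The image of [P] under [(a, b)] is a coupling, whose cost is computed on
   [T] by change of variables. This frees all later estimates from working
   directly with couplings. *)
Lemma GW_le_realization d (T : measurableType d) (P : probability T R) X Y
    (a : T -> bor X) (b : T -> bor Y) :
  measurable_fun [set: T] a -> measurable_fun [set: T] b ->
  is_pushforward a P (law X) -> is_pushforward b P (law Y) ->
  (GW X Y <= 2^-1%:E *
     kernel_dist P p (pullback a (kernel X)) (pullback b (kernel Y)))%E.
Proof.
move=> ma mb aPX bPY; rewrite /GW lee_pmul2l// ?lte_fin ?invr_gt0//.
have mab := measurable_fun_pair ma mb.
pose ab : {mfun T >-> (bor X * bor Y)%type} :=
  HB.pack (fun t => (a t, b t)) (isMeasurableFun.Build _ _ _ _ _ mab).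
apply: ereal_inf_lbound; exists (distribution P ab).
  split => A mA; rewrite /pushforward/=.
  - exact: aPX.
  - exact: bPY.
have mX : measurable_kernel Z
    (pullback (fst : bor X * bor Y -> bor X) (kernel X)).
  by apply: measurable_pullback => //; exact: measurable_kernel_network.
have mY : measurable_kernel Z
    (pullback (snd : bor X * bor Y -> bor Y) (kernel Y)).
  by apply: measurable_pullback => //; exact: measurable_kernel_network.
exact: (@kernel_dist_pushforward _ _ p separable_Z _ _ _ _ _
  (distribution P ab) ab mab _ _ _ mX mY).
Qed.

Lemma GW_lt_coupling X Y (e : \bar R) : (GW X Y < e)%E ->
  exists2 P : probability (bor X * bor Y)%type R,
    is_pushforward fst P (law X) /\ is_pushforward snd P (law Y) &
    (2^-1%:E * kernel_dist P p
       (pullback (fst : bor X * bor Y -> bor X) (kernel X))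
       (pullback (snd : bor X * bor Y -> bor Y) (kernel Y)) < e)%E.
Proof.
rewrite /GW -lte_pdivlMl ?invr_gt0// => /ereal_inf_lt[_ [P XYP <-]] Pe.
by exists P => //; rewrite -lte_pdivlMl ?invr_gt0.
Qed.

Lemma GW_ge0 X Y : (0 <= GW X Y)%E.
Proof.
rewrite /GW mule_ge0// ?lee_fin ?invr_ge0//.
by apply: le_ereal_inf_tmp => _ [P _ <-]; exact: Lnorm_ge0.
Qed.

Lemma GW_eq0 d (T : measurableType d) (P : probability T R) X Y
    (a : T -> bor X) (b : T -> bor Y) :
  measurable_fun [set: T] a -> measurable_fun [set: T] b ->
  is_pushforward a P (law X) -> is_pushforward b P (law Y) ->
  {ae (P \x P)%E, forall u,
     pullback a (kernel X) u = pullback b (kernel Y) u} ->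
  GW X Y = 0%E.
Proof.
move=> ma mb aPX bPY ab; apply/eqP; rewrite eq_le GW_ge0 andbT.
apply: (le_trans (GW_le_realization ma mb aPX bPY)).
rewrite (kernel_dist_ae0 separable_Z p_ge1 _ _ ab) ?mule0//;
  by apply: measurable_pullback => //; exact: measurable_kernel_network.
Qed.

Lemma GW_sym X Y : GW X Y = GW Y X.
Proof.
suff le_GW : forall U V : network Z p, (GW U V <= GW V U)%E.
  by apply/eqP; rewrite eq_le !le_GW.
move=> U V; rewrite leNgt; apply/negP => /GW_lt_coupling[P [PV PU]].
rewrite ltNge => /negP; apply; rewrite kernel_dist_sym.
exact: GW_le_realization.
Qed.

Lemma weakly_isomorphic_refl X : weakly_isomorphic X X.
Proof.
exists X, id, id; split; [exact: measurable_id|exact: measurable_id|by []|by []|].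
by apply: aeW => -[w w'].
Qed.

Lemma weakly_isomorphic_GW X Y : weakly_isomorphic X Y -> GW X Y = 0%E.
Proof.
move=> [W [f [g [mf mg fWX gWY WXY]]]].
apply: (GW_eq0 mf mg fWX gWY).
by apply: filterS WXY => u [Wf Wg]; rewrite /pullback /kernel -Wf -Wg.
Qed.

End realizations.
Arguments kernel {R Z p} X _.
Arguments measurable_kernel_network {R Z p} X.

(** * Approximation of measurable sets by unions of rectangles *)

(** Continuity from above: the tails decrease to the empty set. *)
Lemma measure_bigcup_tail d (T : measurableType d) (R : realType)
    (P : probability T R) (E : (set T)^nat) (e : R) :
  (forall n, measurable (E n)) -> 0 < e ->
  exists N, (P (\bigcup_n E n `\` \big[setU/set0]_(n < N) E n) < e%:E)%E.
Proof.
move=> mE e0.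
pose G N := \bigcup_n E n `\` \big[setU/set0]_(n < N) E n.
have mG N : measurable (G N).
  apply: measurableD; first exact: bigcup_measurable.
  by apply: bigsetU_measurable => n _; exact: mE.
have capG : \bigcap_n G n = set0.
  rewrite -subset0 => x Gx; have [[n _ Enx] _] := Gx 0%N I.
  have [_] := Gx n.+1 I; apply; rewrite big_ord_recr/=; right => //.
have : P \o G @ \oo --> P (\bigcap_n G n).
  apply: nonincreasing_cvg_mu => //.
  - by rewrite (le_lt_trans (probability_le1 _ _))// ltry.
  - by rewrite capG.
  - move=> m n mn; apply/subsetPset; apply: setDS.
    exact: subset_bigsetU.
rewrite capG measure0 => /(_ [set y | (y < e%:E)%E]) [].
  by apply: open_nbhs_nbhs; split; [exact: open_ereal_lt_ereal|rewrite /= lte_fin].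
by move=> N _ NP; exists N; exact: (NP N (leqnn N)).
Qed.

Section rectangular_approximation.
Context d (T : measurableType d) (R : realType) (P : probability T R).
Local Notation PP := (P \x P)%E.

Definition fibers_measurable (I : Type) (f : T -> I) :=
  forall i, measurable (f @^-1` [set i]).

(** A finite union of measurable rectangles, presented by the finite partition of
   [T] that its sides generate; in this form the class is visibly closed
   under complements and unions, and it is what gluing requires. *)
Definition rectangular (E : set (T * T)) :=
  exists (I : finType) (f : T -> I) (G : pred (I * I)),
    fibers_measurable f /\ E = [set u | G (f u.1, f u.2)].

Lemma fibers_measurable_pair (I J : Type) (f : T -> I) (g : T -> J) :
  fibers_measurable f -> fibers_measurable g ->
  fibers_measurable (fun t => (f t, g t)).
Proof.
move=> mf mg [i j].
rewrite (_ : _ @^-1` _ = f @^-1` [set i] `&` g @^-1` [set j]).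
  exact: measurableI.
by apply/seteqP; split => t /= [-> ->].
Qed.

Lemma rectangular_measurable E : rectangular E -> measurable E.
Proof.
move=> [I [f [G [mf ->]]]].
rewrite (_ : [set _ | _] = \bigcup_(ij in [set` G])
    ((f @^-1` [set ij.1]) `*` (f @^-1` [set ij.2]))).
  apply: fin_bigcup_measurable => //.
  by move=> [i j] _; exact: measurableX.
apply/seteqP; split => [[x y] /= Gxy|[x y] /=].
  by exists (f x, f y).
by case=> -[i j] Gij [/= xi yj]; rewrite xi yj.
Qed.

Lemma rectangularC E : rectangular E -> rectangular (~` E).
Proof.
move=> [I [f [G [mf ->]]]]; exists I, f, (predC G); split => //.
by apply/seteqP; split => u /= /negP.
Qed.

Lemma rectangularU E F : rectangular E -> rectangular F ->
  rectangular (E `|` F).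
Proof.
move=> [I [f [G [mf ->]]]] [J [g [H [mg ->]]]].
exists (I * J)%type, (fun t => (f t, g t)),
  (fun u => G (u.1.1, u.2.1) || H (u.1.2, u.2.2)); split.
  exact: fibers_measurable_pair.
by apply/seteqP; split => u /= /orP.
Qed.

Lemma rectangularX A B : measurable A -> measurable B ->
  rectangular (A `*` B).
Proof.
move=> mA mB; exists (bool * bool)%type, (fun t => (t \in A, t \in B)),
  (fun u => u.1.1 && u.2.2); split; last first.
  apply/seteqP; split => [[x y] /= [Ax By]|[x y] /= /andP[]].
    by rewrite !mem_set.
  by rewrite !inE.
have mfib C : measurable C -> fibers_measurable (fun t : T => t \in C).
  move=> mC [].
    rewrite (_ : _ @^-1` _ = C)//.
    by apply/seteqP; split => t /=; [exact: set_mem|exact: mem_set].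
  rewrite (_ : _ @^-1` _ = ~` C); first exact: measurableC.
  apply/seteqP; split => t /=; last exact: memNset.
  by move=> /negbT; rewrite notin_setE.
by apply: fibers_measurable_pair; exact: mfib.
Qed.

Lemma rectangular0 : rectangular set0.
Proof.
exists unit, (fun=> tt), (fun=> false); split=> [[]|].
  by rewrite (_ : _ @^-1` _ = [set: T])//; apply/seteqP; split.
by apply/seteqP; split.
Qed.

Definition approximable E := forall e : R, 0 < e ->
  exists2 F, rectangular F & (PP (E `+` F) < e%:E)%E.

Lemma measurable_setY (E F : set (T * T)) : measurable E -> measurable F ->
  measurable (E `+` F).
Proof. by move=> mE mF; apply: measurableU; exact: measurableD. Qed.

Lemma approximable_rectangular E : rectangular E -> approximable E.
Proof. by move=> rE e e0; exists E; rewrite // setYK measure0. Qed.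

Lemma approximableC E : approximable E -> approximable (~` E).
Proof.
move=> aE e e0; have [F rF EF] := aE e e0.
exists (~` F); first exact: rectangularC.
rewrite (_ : ~` E `+` ~` F = E `+` F)//.
apply/seteqP; split => u /=; have := pselect (E u); have := pselect (F u);
  tauto.
Qed.

(** Approximable sets are closed for the pseudometric given by the measure of the
   symmetric difference. *)
Lemma approximable_closure E : measurable E ->
  (forall e : R, 0 < e -> exists F,
    [/\ measurable F, approximable F & (PP (E `+` F) < e%:E)%E]) ->
  approximable E.
Proof.
move=> mE aE e e0; have e20 : 0 < e / 2 by rewrite divr_gt0.
have [F [mF aF EF]] := aE _ e20; have [G rG FG] := aF _ e20.
exists G => //.
have mG := rectangular_measurable rG.
apply: (@le_lt_trans _ _ (PP (E `+` F) + PP (F `+` G))%E).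
  apply: (@le_trans _ _ (PP ((E `+` F) `|` (F `+` G)))).
    apply: le_measure; rewrite ?inE.
    - exact: measurable_setY.
    - by apply: measurableU; exact: measurable_setY.
    - by move=> u /=; have := pselect (F u); tauto.
  by apply: measureU2; exact: measurable_setY.
by rewrite [e]splitr EFinD lteD.
Qed.

Lemma approximableU E F : measurable E -> measurable F ->
  approximable E -> approximable F -> approximable (E `|` F).
Proof.
move=> mE mF aE aF e e0; have e20 : 0 < e / 2 by rewrite divr_gt0.
have [E' rE EE] := aE _ e20; have [F' rF FF] := aF _ e20.
exists (E' `|` F'); first exact: rectangularU.
have mE' := rectangular_measurable rE; have mF' := rectangular_measurable rF.
apply: (@le_lt_trans _ _ (PP (E `+` E') + PP (F `+` F'))%E).
  apply: (@le_trans _ _ (PP ((E `+` E') `|` (F `+` F')))).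
    apply: le_measure; rewrite ?inE.
    - by apply: measurable_setY; exact: measurableU.
    - by apply: measurableU; exact: measurable_setY.
    - by move=> u /=; tauto.
  by apply: measureU2; exact: measurable_setY.
by rewrite [e]splitr EFinD lteD.
Qed.

(** The rectangles generate the product sigma-algebra, and the approximable
   measurable sets form a sigma-algebra that contains them. *)
Lemma measurable_approximable E : measurable E -> approximable E.
Proof.
move=> mE; suff [] : measurable E /\ approximable E by [].
move: E mE; rewrite {1}measurable_prod_measurableType.
apply: smallest_sub; last first.
  move=> _ [A mA [B mB <-]]; split; first exact: measurableX.
  by apply: approximable_rectangular; exact: rectangularX.
split.
- split; first exact: measurable0.
  exact: approximable_rectangular rectangular0.
- move=> A [mA aA]; rewrite setTD; split; first exact: measurableC.
  exact: approximableC.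
- move=> E mE; have mE' n : measurable (E n) by have [] := mE n.
  split; first exact: bigcup_measurable.
  apply: approximable_closure; first exact: bigcup_measurable.
  move=> e e0; have [N NE] := @measure_bigcup_tail _ _ _ PP E e mE' e0.
  have mU n : measurable (\big[setU/set0]_(i < n) E i).
    by apply: bigsetU_measurable => i _; exact: mE'.
  exists (\big[setU/set0]_(n < N) E n); split => //.
    elim: N {NE} => [|N IH].
      by rewrite big_ord0; exact: approximable_rectangular rectangular0.
    rewrite big_ord_recr/=; have [mEN aEN] := mE N.
    by apply: approximableU; [exact: mU|exact: mEN|exact: IH|exact: aEN].
  rewrite /setY (_ : _ `\` \bigcup_n E n = set0) ?setU0//.
  by rewrite setD_eq0; exact: bigsetU_bigcup.
Qed.

End rectangular_approximation.

(** * Approximation of kernels by step kernels *)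

Section step_approximation.
Context d (T : measurableType d) (R : realType) (P : probability T R).
Context (Z : completeMetricType R) (p : R).
Hypotheses (separable_Z : separable Z) (p_ge1 : 1 <= p).
Local Notation PP := (P \x P)%E.
Implicit Types v w : T * T -> Z.

Local Notation kdist := (kernel_dist P p).

Definition step_approximable v := forall e : R, 0 < e ->
  exists (I : finType) (f : T -> I) (zeta : I * I -> Z),
    fibers_measurable f /\
    (kdist v (pullback f zeta) <= e%:E)%E.

Lemma measurable_step (I : finType) (f : T -> I) (zeta : I * I -> Z) :
  fibers_measurable f -> measurable_kernel Z (pullback f zeta).
Proof.
move=> mf _ A mA; rewrite setTI; apply: rectangular_measurable.
exists I, f, (fun ij => `[< A (zeta ij) >]); split => //.
by apply/seteqP; split => u /= /asboolP.
Qed.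

Lemma step_approximable_cst z : step_approximable (fun=> z).
Proof.
move=> e e0; exists unit, (fun=> tt), (fun=> z); split.
  by case; rewrite (_ : _ @^-1` _ = [set: T])//; apply/seteqP; split.
by rewrite kernel_dist_cst// mdistxx lee_fin ltW.
Qed.

Lemma measurable_update v (E : set (T * T)) z : measurable E ->
  measurable_kernel Z v ->
  measurable_kernel Z (fun u => if u \in E then z else v u).
Proof.
move=> mE mv; apply: measurable_fun_ifT; [|exact: measurable_cst|exact: mv].
apply: (measurable_fun_bool true); rewrite setTI (_ : _ @^-1` _ = E)//.
by apply/seteqP; split => u /=; [exact: set_mem|exact: mem_set].
Qed.

(** Approximate [v] by a step kernel and [E] by a union of rectangles [F]. Off
   [E `+` F] the modified step kernel is as good as before; on [E `+` F] the
   extra error is at most [d(z, v)], whose norm on that small set is small. *)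
Lemma step_approximable_update v (E : set (T * T)) z : measurable E ->
  measurable_kernel Z v -> (kdist (fun=> z) v < +oo)%E ->
  step_approximable v ->
  step_approximable (fun u => if u \in E then z else v u).
Proof.
move=> mE mv zv av e e0; have e20 : 0 < e / 2 by rewrite divr_gt0.
have mzv : measurable_fun [set: T * T] (fun u => mdist z (v u)).
  by apply: (measurable_fun_mdist separable_Z) => //; exact: measurable_cst.
have [I [f [zeta [mf fP]]]] := av _ e20.
have [r r0 rP] := Lnorm_indic_small p_ge1 mzv zv e20.
have [F rF EF] := measurable_approximable P mE r0.
have {rP EF} := rP _ (measurable_setY mE (rectangular_measurable rF)) EF.
have mF := rectangular_measurable rF.
move: rF mF => [J [g [G [mg ->]]]] mF zvP.
exists (I * J)%type, (fun t => (f t, g t)),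
  (fun ij => if G (ij.1.2, ij.2.2) then z else zeta (ij.1.1, ij.2.1)).
have mfg := fibers_measurable_pair mf mg; split=> //.
rewrite [e]splitr EFinD; apply: le_trans (leeD fP zvP).
apply: Lnorm_triangle => //.
- apply: (measurable_fun_mdist separable_Z); first exact: (measurable_update z mE mv).
  exact: (measurable_step (fun ij : (I * J) * (I * J) =>
    if G (ij.1.2, ij.2.2) then z else zeta (ij.1.1, ij.2.1)) mfg).
- by apply: (measurable_fun_mdist separable_Z) => //; exact: (measurable_step zeta mf).
- by apply: measurable_funM => //; apply: measurable_indic; exact: measurable_setY.
move=> u; rewrite mdist_ge0/= indicE /pullback/=.
set F' := [set u | _]; rewrite (_ : G _ = (u \in F')); last first.
  by apply/idP/idP; [move=> Gu; rewrite inE|rewrite inE].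
rewrite in_setU !in_setD.
case: (u \in E); case: (u \in F') => /=.
- by rewrite mdistxx mul0r addr0 mdist_ge0.
- by rewrite mul1r addrC metric_triangle.
- by rewrite mul1r metric_sym lerDr mdist_ge0.
- by rewrite mul0r addr0.
Qed.

(** Countably many small balls cover [Z]. Replacing the values of [w] in the first
   [N] of them by the centers, and the other values by [z0], gives a kernel with
   finitely many values. It is close to [w] where one of the [N] balls is hit;
   elsewhere the error is [d(w, z0)], on a set that is small for [N] large. *)
Lemma kernel_step_approximable w z0 : measurable_kernel Z w ->
  (kdist w (fun=> z0) < +oo)%E -> step_approximable w.
Proof.
move=> mw wz0 e e0; have e30 : 0 < e / 3 by rewrite divr_gt0.
have mcst (z : Z) : measurable_kernel Z (fun _ : T * T => z).
  exact: measurable_cst.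
have [z_ z_dense] := dense_sequence separable_Z.
pose E n := [set u | mdist (w u) (z_ n) < e / 3].
have mE n : measurable (E n).
  have /(_ measurableT `]-oo, e / 3[%classic) :=
    measurable_fun_mdist separable_Z mw (mcst (z_ n)).
  rewrite setTI => /(_ (measurable_itv _)).
  by rewrite (_ : _ @^-1` _ = E n) ?setTI.
(* The latest ball that is hit decides: [v n] need only be close to [w] where one
   of the first [n] balls is hit, so the balls are not made disjoint. *)
pose fix v n := if n is m.+1 then fun u => if u \in E m then z_ m else v m u
                else fun=> z0.
have mv n : measurable_kernel Z (v n).
  by elim: n => [|n IH] /=; [exact: mcst|exact: (measurable_update _ (mE _) IH)].
have mdv n z : measurable_fun [set: T * T] (fun u => mdist z (v n u)).
  exact: (measurable_fun_mdist separable_Z).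
have vfin n z : (kdist (fun=> z) (v n) < +oo)%E.
  elim: n => [|n IH].
    by rewrite /= kernel_dist_cst ?ltry.
  apply: (@le_lt_trans _ _ (kdist (fun=> z) (v n) +
                            kdist (fun=> z) (fun=> z_ n)))%E.
    apply: Lnorm_triangle; [exact: p_ge1|exact: (mdv n.+1 z)|exact: (mdv n z)|
      exact: measurable_cst|].
    move=> u; rewrite mdist_ge0/=; case: ifP => _.
      by rewrite lerDr mdist_ge0.
    by rewrite lerDl mdist_ge0.
  by rewrite lte_add_pinfty// kernel_dist_cst ?ltry.
have av n : step_approximable (v n).
  elim: n => [|n IH] /=; first exact: step_approximable_cst.
  exact: (step_approximable_update (mE n) (mv n) (vfin n _) IH).
have mwz0 : measurable_fun [set: T * T] (fun u => mdist (w u) z0).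
  exact: (measurable_fun_mdist separable_Z).
have [r r0 rP] := Lnorm_indic_small p_ge1 mwz0 wz0 e30.
have [N NP] := @measure_bigcup_tail _ _ _ PP E r mE r0.
have Ecover : \bigcup_n E n = setT.
  apply/seteqP; split => // u _; have [n un] := z_dense (w u) _ e30.
  by exists n.
rewrite Ecover setTD in NP.
set B := ~` _ in NP.
have mB : measurable B.
  by apply: measurableC; apply: bigsetU_measurable => n _; exact: mE.
have {rP NP} wB := rP B mB NP.
have wvN u : mdist (w u) (v N u) <= e / 3 + \1_B u * mdist (w u) z0.
  have [vz|small] : (v N u = z0 /\ B u) \/ mdist (w u) (v N u) <= e / 3.
  - rewrite /B; elim: (N) => [|n IH] /=.
      by left; split => //; rewrite big_ord0 => -[].
    rewrite big_ord_recr/=; case: ifPn => [/set_mem/ltW|]; first by right.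
    rewrite notin_setE => nE; case: IH => [[-> nB]|]; last by right.
    by left; split => // -[].
  - by have [-> Bu] := vz; rewrite indicE mem_set// mul1r lerDr ltW.
  - rewrite (le_trans small)// lerDl mulr_ge0 ?mdist_ge0// indicE.
have [I [f [zeta [mf fP]]]] := av N _ e30.
exists I, f, zeta; split => //.
have -> : e = e / 3 + e / 3 + e / 3 by lra.
apply: (le_trans (kernel_dist_triangle separable_Z p_ge1 P mw (mv N)
  (measurable_step zeta mf))).
rewrite EFinD; apply: leeD => //; rewrite EFinD.
have cst3 : Lnorm PP p%:E (EFin \o (fun=> e / 3)) = (e / 3)%:E.
  by apply: (Lnorm_cst_ge0 p_ge1); [exact: probability_setT|exact: ltW].
rewrite -{1}cst3; apply: le_trans (leeD (lexx _) wB).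
apply: Lnorm_triangle => //.
  - exact: (measurable_fun_mdist separable_Z).
  - by apply: measurable_funM => //; exact: measurable_indic.
  - by move=> u; rewrite mdist_ge0 wvN.

Qed.

End step_approximation.

(** * Gluing two couplings along a finite partition *)

Section gluing.
Context d1 d2 (T1 : measurableType d1) (T2 : measurableType d2) (R : realType).
Variables (s : probability T1 R) (q : probability T2 R).
Variables (n : nat) (f : T1 -> nat) (g : T2 -> nat).
Hypotheses (f_lt : forall t, (f t < n)%N) (g_lt : forall t, (g t < n)%N).
Hypotheses (mf : fibers_measurable f) (mg : fibers_measurable g).
Hypothesis fg_law : forall k, s (f @^-1` [set k]) = q (g @^-1` [set k]).

Let D k : set (T1 * T2) := (f @^-1` [set k]) `*` (g @^-1` [set k]).

Let mD k : measurable (D k). Proof. exact: measurableX. Qed.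

Let c_ge0 k : 0 <= (fine (s (f @^-1` [set k])))^-1.
Proof. by rewrite invr_ge0 fine_ge0. Qed.

(** The law of a pair that is conditionally independent given the common value
   [k] of [f] and [g]. A value [k] of probability [0] contributes nothing, as its
   coefficient is [0^-1 = 0]. *)
Definition glue : set (T1 * T2) -> \bar R :=
  msum (fun k => mscale (NngNum (c_ge0 k)) (mrestr (s \x q)%E (mD k))) n.

HB.instance Definition _ := Measure.on glue.

Let glueE A : glue A = (\sum_(k < n)
  ((fine (s (f @^-1` [set (k : nat)])))^-1%:E * (s \x q) (A `&` D k)))%E.
Proof. by []. Qed.

Let partition_measure d (T : measurableType d) (m : probability T R)
    (h : T -> nat) A :
  (forall t, (h t < n)%N) -> fibers_measurable h -> measurable A ->
  m A = (\sum_(k < n) m (A `&` h @^-1` [set (k : nat)]))%E.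
Proof.
move=> h_lt mh mA; rewrite -(measure_bigsetU m (F := fun k => A `&` h @^-1` [set k])).
- congr (m _); apply/seteqP; split => [t At|t].
    by rewrite -(bigcup_mkord n (fun k => A `&` h @^-1` [set k])); exists (h t) => /=.
  by rewrite -(bigcup_mkord n (fun k => A `&` h @^-1` [set k])) => -[k _ []].
- by move=> k; exact: measurableI.
- by move=> i j _ _ [t [[_ /= <-] [_ /= <-]]].
Qed.

Lemma glue_fst A : measurable A -> glue (A `*` [set: T2]) = s A.
Proof.
move=> mA; rewrite glueE (partition_measure s f_lt mf mA).
apply: eq_bigr => k _.
rewrite (_ : _ `&` D k = (A `&` f @^-1` [set (k : nat)]) `*` (g @^-1` [set (k : nat)])).
  have mAk : measurable (A `&` f @^-1` [set (k : nat)]) by exact: measurableI.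
  have -> : (s \x q)%E
      ((A `&` f @^-1` [set (k : nat)]) `*` (g @^-1` [set (k : nat)])) =
      (s (A `&` f @^-1` [set (k : nat)]) * s (f @^-1` [set (k : nat)]))%E.
    by rewrite fg_law; apply: product_measure1E => //; exact: mg.
  have [s0|s_neq0] := eqVneq (s (f @^-1` [set (k : nat)])) 0%E.
    rewrite s0 mule0 mule0; apply/esym/eqP; rewrite eq_le measure_ge0 andbT.
    by rewrite -s0 le_measure ?inE.
  have sfin : s (f @^-1` [set (k : nat)]) \is a fin_num by exact: fin_num_measure.
  rewrite muleC -muleA -{1}(fineK sfin) -EFinM mulfV ?mule1//.
  by rewrite fine_eq0.
by rewrite /D -setXI setTI.
Qed.

Lemma glue_snd B : measurable B -> glue ([set: T1] `*` B) = q B.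
Proof.
move=> mB; rewrite glueE (partition_measure q g_lt mg mB).
apply: eq_bigr => k _.
rewrite (_ : _ `&` D k = (f @^-1` [set (k : nat)]) `*` (B `&` g @^-1` [set (k : nat)])).
  have mBk : measurable (B `&` g @^-1` [set (k : nat)]) by exact: measurableI.
  have -> : (s \x q)%E
      ((f @^-1` [set (k : nat)]) `*` (B `&` g @^-1` [set (k : nat)])) =
      (s (f @^-1` [set (k : nat)]) * q (B `&` g @^-1` [set (k : nat)]))%E.
    by apply: product_measure1E => //; exact: mf.
  have [s0|s_neq0] := eqVneq (s (f @^-1` [set (k : nat)])) 0%E.
    rewrite s0 mul0e mule0; apply/esym/eqP; rewrite eq_le measure_ge0 andbT.
    by rewrite -s0 fg_law le_measure ?inE.
  have sfin : s (f @^-1` [set (k : nat)]) \is a fin_num by exact: fin_num_measure.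
  rewrite muleA -{2}(fineK sfin) -EFinM mulVf ?mul1e//.
  by rewrite fine_eq0.
by rewrite /D -setXI setTI.
Qed.

Let glue_setT : glue [set: T1 * T2] = 1%E.
Proof. by rewrite -setXTT glue_fst// probability_setT. Qed.

HB.instance Definition _ := Measure_isProbability.Build _ _ _ glue glue_setT.

Lemma exists_gluing : exists P : probability (T1 * T2)%type R,
  [/\ is_pushforward fst P s, is_pushforward snd P q &
      {ae P, forall u, f u.1 = g u.2}].
Proof.
exists glue; split.
- move=> A mA; rewrite -glue_fst// /pushforward; congr (glue _).
  by apply/seteqP; split => [[x y]|[x y]] /=; tauto.
- move=> A mA; rewrite -glue_snd// /pushforward; congr (glue _).
  by apply/seteqP; split => [[x y]|[x y]] /=; tauto.
exists (~` \bigcup_k D k); split.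
- by apply: measurableC; exact: bigcup_measurable.
- transitivity (glue (~` \bigcup_k D k)); first by [].
  rewrite glueE big1// => k _; rewrite (_ : _ `&` _ = set0) ?measure0 ?mule0//.
  by apply/seteqP; split => // u [nD Dk]; apply: nD; exists k.
- by move=> u /= fgu [k _ [/= fk gk]]; apply: fgu; rewrite fk gk.
Qed.

End gluing.

(** * The triangle inequality *)

Lemma is_pushforward_comp d1 d2 d3 (T1 : measurableType d1)
    (T2 : measurableType d2) (T3 : measurableType d3) (R : realType)
    (f : T1 -> T2) (g : T2 -> T3) (P : set T1 -> \bar R) (Q : set T2 -> \bar R)
    (S : set T3 -> \bar R) :
  measurable_fun [set: T2] g -> is_pushforward f P Q -> is_pushforward g Q S ->
  is_pushforward (g \o f) P S.
Proof.
move=> mg fPQ gQS A mA; rewrite -(gQS _ mA) /pushforward -fPQ//.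
by rewrite -[_ @^-1` _]setTI; exact: mg.
Qed.

Lemma fibers_measurable_postcomp d (T : measurableType d) (I : finType)
    (J : Type) (f : T -> I) (h : I -> J) :
  fibers_measurable f -> fibers_measurable (h \o f).
Proof.
move=> mf j; rewrite (_ : _ @^-1` _ =
    \bigcup_(i in [set i | h i = j]) f @^-1` [set i]).
  by apply: fin_bigcup_measurable => // i _; exact: mf.
by apply/seteqP; split => [t hft|t [i <- <-]//]; exists (f t).
Qed.

Lemma fibers_measurable_precomp d d' (S : measurableType d)
    (T : measurableType d') (J : Type) (a : S -> T) (f : T -> J) :
  measurable_fun [set: S] a -> fibers_measurable f ->
  fibers_measurable (f \o a).
Proof.
move=> ma mf j; rewrite comp_preimage -[_ @^-1` _]setTI.
by apply: ma => //; exact: mf.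
Qed.

Lemma product_ae d (T : measurableType d) (R : realType) (P : probability T R)
    (A : T -> Prop) :
  {ae P, forall t, A t} -> {ae (P \x P)%E, forall u, A u.1 /\ A u.2}.
Proof.
move=> [B [mB PB AB]]; exists ((B `*` [set: T]) `|` ([set: T] `*` B)); split.
- by apply: measurableU; exact: measurableX.
- apply/eqP; rewrite eq_le measure_ge0 andbT.
  have mBT : measurable (B `*` [set: T]) by exact: measurableX.
  have mTB : measurable ([set: T] `*` B) by exact: measurableX.
  have BT0 : (P \x P)%E (B `*` [set: T]) = 0%E.
    by transitivity (P B * P [set: T])%E;
      [exact: product_measure1E|rewrite PB mul0e].
  have TB0 : (P \x P)%E ([set: T] `*` B) = 0%E.
    by transitivity (P [set: T] * P B)%E;
      [exact: product_measure1E|rewrite PB mule0].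
  apply: (le_trans (@measureU2 _ _ _ (P \x P)%E _ _ mBT mTB)).
  rewrite -[leRHS]adde0; apply: leeD.
  - by rewrite le_eqVlt; apply/orP; left; apply/eqP; exact: BT0.
  - by rewrite le_eqVlt; apply/orP; left; apply/eqP; exact: TB0.
- move=> [x y] /= nA; have [Ax|nAx] := pselect (A x).
    by right; split => //; apply: AB => /= Ay; apply: nA.
  by left; split => //; apply: AB.
Qed.

Section gluing_kernels.
Context d1 d2 d3 (S1 : measurableType d1) (S2 : measurableType d2)
  (S3 : measurableType d3) (R : realType).
Context (Z : completeMetricType R) (p : R).
Hypotheses (separable_Z : separable Z) (p_ge1 : 1 <= p).
Variables (P : probability (S1 * S2)%type R) (Q : probability (S2 * S3)%type R)
  (m : probability S2 R).
Hypotheses (Pm : is_pushforward snd P m) (Qm : is_pushforward fst Q m).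
Variables (v1 : S1 * S1 -> Z) (v2 : S2 * S2 -> Z) (v3 : S3 * S3 -> Z).
Hypotheses (mv1 : measurable_kernel Z v1) (mv2 : measurable_kernel Z v2)
  (mv3 : measurable_kernel Z v3).

(** The chain of kernels on the glued space is: [v1]; [v2] at the first copy of
   the point of [S2]; its step approximation there; the same at the second copy;
   [v2] at the second copy; [v3]. The two step kernels agree almost surely, since
   both copies lie in the same cell. *)
Lemma kernel_dist_glue (e : R) : step_approximable m p v2 -> 0 < e ->
  exists G : probability ((S1 * S2) * (S2 * S3))%type R,
    [/\ is_pushforward fst G P, is_pushforward snd G Q &
        (kernel_dist G p (pullback (fst \o fst) v1) (pullback (snd \o snd) v3)
         <= kernel_dist P p (pullback fst v1) (pullback snd v2) +
            kernel_dist Q p (pullback fst v2) (pullback snd v3) + (e + e)%:E)%E].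
Proof.
move=> av2 e0; have [I [f [zeta [mf fe]]]] := av2 e e0.
pose h : S2 -> nat := (fun i : I => enum_rank i : nat) \o f.
have h_lt y : (h y < #|I|)%N by rewrite /h/= ltn_ord.
have mh : fibers_measurable h by exact: fibers_measurable_postcomp.
pose y1 : S1 * S2 -> S2 := snd.
pose y2 : S2 * S3 -> S2 := fst.
have my1 : measurable_fun [set: S1 * S2] y1 by exact: measurable_snd.
have my2 : measurable_fun [set: S2 * S3] y2 by exact: measurable_fst.
have fiber_law k :
    P ((h \o y1) @^-1` [set k]) = Q ((h \o y2) @^-1` [set k]).
  transitivity (m (h @^-1` [set k])); first exact: (Pm (mh k)).
  by apply/esym; exact: (Qm (mh k)).
have [G [GP GQ Gh]] := @exists_gluing _ _ _ _ _ P Q #|I| (h \o y1) (h \o y2)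
  (fun t => h_lt _) (fun t => h_lt _) (fibers_measurable_precomp my1 mh)
  (fibers_measurable_precomp my2 mh) fiber_law.
exists G; split => //.
set D1 := kernel_dist P _ _ _; set D2 := kernel_dist Q _ _ _.
pose T := ((S1 * S2) * (S2 * S3))%type.
pose s1 : T -> S1 * S2 := fst.
pose s2 : T -> S2 * S3 := snd.
have ms1 : measurable_fun [set: (S1 * S2) * (S2 * S3)] s1.
  exact: measurable_fst.
have ms2 : measurable_fun [set: (S1 * S2) * (S2 * S3)] s2.
  exact: measurable_snd.
have mfz : measurable_kernel Z (pullback f zeta) by exact: measurable_step.
have mP0 : measurable_kernel Z (pullback (fst : S1 * S2 -> S1) v1).
  exact: (measurable_pullback measurable_fst mv1).
have mP1 := measurable_pullback my1 mv2.
have mP2 := measurable_pullback my1 mfz.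
have mQ3 := measurable_pullback my2 mfz.
have mQ4 := measurable_pullback my2 mv2.
have mQ5 : measurable_kernel Z (pullback (snd : S2 * S3 -> S3) v3).
  exact: (measurable_pullback measurable_snd mv3).
have m0 := measurable_pullback ms1 mP0.
have m1 := measurable_pullback ms1 mP1.
have m2 := measurable_pullback ms1 mP2.
have m3 := measurable_pullback ms2 mQ3.
have m4 := measurable_pullback ms2 mQ4.
have m5 := measurable_pullback ms2 mQ5.
set k0 := pullback s1 _ in m0; set k1 := pullback s1 _ in m1.
set k2 := pullback s1 _ in m2; set k3 := pullback s2 _ in m3.
set k4 := pullback s2 _ in m4; set k5 := pullback s2 _ in m5.
have d01 : kernel_dist G p k0 k1 = D1.
  by apply/esym; exact: (kernel_dist_pushforward p separable_Z ms1 GP).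
have d45 : kernel_dist G p k4 k5 = D2.
  by apply/esym; exact: (kernel_dist_pushforward p separable_Z ms2 GQ).
have d12 : (kernel_dist G p k1 k2 <= e%:E)%E.
  rewrite -(kernel_dist_pushforward p separable_Z ms1 GP mP1 mP2).
  by rewrite -(kernel_dist_pushforward p separable_Z my1 Pm).
have d34 : (kernel_dist G p k3 k4 <= e%:E)%E.
  rewrite kernel_dist_sym.
  rewrite -(kernel_dist_pushforward p separable_Z ms2 GQ mQ4 mQ3).
  by rewrite -(kernel_dist_pushforward p separable_Z my2 Qm).
have d23 : kernel_dist G p k2 k3 = 0%E.
  apply: (kernel_dist_ae0 separable_Z p_ge1 m2 m3).
  apply: filterS (product_ae Gh) => -[u u'] [/= /ord_inj/enum_rank_inj hu].
  by move=> /ord_inj/enum_rank_inj hu'; rewrite /k2 /k3 /pullback/= hu hu'.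
have tri := kernel_dist_triangle separable_Z p_ge1 G.
apply: (le_trans (tri k1 k0 k5 m0 m1 m5)); rewrite d01 -addeA.
apply: leeD; first exact: lexx.
apply: (le_trans (tri k4 k1 k5 m1 m4 m5)); rewrite d45 [leLHS]addeC.
apply: leeD; first exact: lexx.
apply: (le_trans (tri k2 k1 k4 m1 m2 m4)); rewrite EFinD.
apply: leeD; first exact: d12.
by apply: (le_trans (tri k3 k2 k4 m2 m3 m4)); rewrite d23 add0e.
Qed.

End gluing_kernels.

Section GW_triangle.
Context (R : realType) (Z : completeMetricType R) (p : R).
Hypotheses (separable_Z : separable Z) (p_ge1 : 1 <= p).
Implicit Types X Y W : network Z p.

Lemma network_step_approximable X : step_approximable (law X) p (kernel X).
Proof.
have [z0 fin] := weight_Lp X.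
apply: (@kernel_step_approximable _ _ _ (law X) Z p separable_Z p_ge1
  (kernel X) z0 _ fin).
exact: measurable_kernel_network.
Qed.

Lemma GW_triangle X Y W : (GW X W <= GW X Y + GW Y W)%E.
Proof.
have [->|XY] := eqVneq (GW X Y) +oo%E.
  by rewrite addye ?leey// gt_eqF// (lt_le_trans _ (GW_ge0 _ _)).
have [->|YW] := eqVneq (GW Y W) +oo%E.
  by rewrite addey ?leey// gt_eqF// (lt_le_trans _ (GW_ge0 _ _)).
have fXY : GW X Y \is a fin_num by rewrite ge0_fin_numE ?GW_ge0// ltey.
have fYW : GW Y W \is a fin_num by rewrite ge0_fin_numE ?GW_ge0// ltey.
apply/lee_addgt0Pr => e e0.
have e40 : 0 < e / 4 by rewrite divr_gt0.
have /GW_lt_coupling[P [PX PY] Pe] : (GW X Y < GW X Y + (e / 4)%:E)%E.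
  by rewrite lteDl.
have /GW_lt_coupling[Q [QY QW] Qe] : (GW Y W < GW Y W + (e / 4)%:E)%E.
  by rewrite lteDl.
have e20 : 0 < e / 2 by rewrite divr_gt0.
have [G [GP GQ]] := kernel_dist_glue separable_Z p_ge1 PY QY
  (measurable_kernel_network X) (measurable_kernel_network Y)
  (measurable_kernel_network W) (network_step_approximable Y) e20.
set D := (X in (_ <= X)%E) => GD.
apply: (@le_trans _ _ (2^-1%:E * D)%E).
  apply: (@le_trans _ _ (2^-1%:E * kernel_dist G p
      (pullback (fst \o fst) (kernel X)) (pullback (snd \o snd) (kernel W)))%E).
    apply: GW_le_realization => //.
    - exact: measurableT_comp.
    - exact: measurableT_comp.
    - exact: (is_pushforward_comp measurable_fst GP PX).
    - exact: (is_pushforward_comp measurable_snd GQ QW).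
  by rewrite lee_pmul2l ?lte_fin ?invr_gt0.
have ee0 : (0 <= (e / 2 + e / 2)%:E)%E by rewrite lee_fin addr_ge0 ?ltW.
rewrite /D !ge0_muleDr ?adde_ge0 ?kernel_dist_ge0//.
apply: (@le_trans _ _ (GW X Y + (e / 4)%:E + (GW Y W + (e / 4)%:E) +
  (e / 2)%:E)%E).
  apply: leeD; first by apply: leeD; exact: ltW.
  by rewrite -EFinM lee_fin; lra.
by rewrite -(fineK fXY) -(fineK fYW) -!EFinD lee_fin; lra.
Qed.

End GW_triangle.

(** * Two disjoint copies of a Polish space *)

(** A type of its own, since the distance below is not the
   pseudometric that [M * bool] already carries. *)
Definition two_copies (R : realType) (M : completeMetricType R) : Type :=
  (M * bool)%type.

Section two_copies.
Context (R : realType) (M : completeMetricType R).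
Implicit Types x y z : two_copies M.

Definition two_copies_dist x y : R := mdist x.1 y.1 + (x.2 != y.2)%:R.

Let dist_xx x : two_copies_dist x x = 0.
Proof. by rewrite /two_copies_dist mdistxx eqxx addr0. Qed.

Let dist_eq0 x y : two_copies_dist x y = 0 -> x = y.
Proof.
rewrite /two_copies_dist => /eqP; rewrite paddr_eq0 ?mdist_ge0//.
case: x y => [x b] [y c] /= /andP[/eqP/mdist_positivity ->].
by case: b c => [] [] //=; rewrite oner_eq0.
Qed.

Let dist_sym x y : two_copies_dist x y = two_copies_dist y x.
Proof. by rewrite /two_copies_dist metric_sym eq_sym. Qed.

Let dist_triangle y x z :
  two_copies_dist x z <= two_copies_dist x y + two_copies_dist y z.
Proof.
rewrite /two_copies_dist addrACA lerD ?metric_triangle//.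
rewrite -natrD ler_nat.
by case: x y z => [? []] [? []] [? []].
Qed.

HB.instance Definition _ := Choice.on (two_copies M).
HB.instance Definition _ := isPointed.Build (two_copies M) (point, true).
HB.instance Definition _ := @isMetric.Build R (two_copies M)
  two_copies_dist dist_xx dist_eq0 dist_sym dist_triangle.

(** Balls of radius at most [1] do not meet both copies. *)
Lemma two_copies_ball x (e : R) y : e <= 1 ->
  ball x e y <-> mdist x.1 y.1 < e /\ x.2 = y.2.
Proof.
move=> e1; rewrite ballEmdist/= /mdist/= /two_copies_dist.
case: eqVneq => [->|xy]; first by rewrite addr0; split => [|[]].
split => [xye|[_ xyE]]; last by rewrite xyE eqxx in xy.
suff : 1 < 1 :> R by rewrite ltxx.
rewrite (le_lt_trans _ (lt_le_trans xye e1))// lerDr; exact: mdist_ge0.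
Qed.

(** A Cauchy filter lives in one of the copies. *)
Let two_copies_cauchy (F : set_system (two_copies M)) :
  ProperFilter F -> cauchy F -> cvg F.
Proof.
move=> FF /cauchyP Fc.
have [x1 Fx1] := Fc 1 ltr01.
have Fb : F [set y | y.2 = x1.2].
  by apply: filterS Fx1 => y /(two_copies_ball _ _ (lexx _))[].
have F1c : cauchy (fst @ F : set_system M).
  apply/cauchyP => e e0.
  have [|x Fx] := Fc (Num.min e 1); first by rewrite lt_min e0 ltr01.
  have e1 : Num.min e 1 <= 1 by rewrite ge_min lexx orbT.
  exists x.1; have : F [set y | ball x.1 e y.1]; last by [].
  apply: filterS Fx => y xy; have [{}xy _] := (two_copies_ball x y e1).1 xy.
  by rewrite /= ballEmdist/= (lt_le_trans xy)// ge_min lexx.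
have [l /cvg_ballP Fl] : exists l : M, fst @ F --> l.
  by apply/cvg_ex; exact: cauchy_cvg.
apply/cvg_ex; exists ((l, x1.2) : two_copies M); apply/cvg_ballP => e e0.
have m0 : 0 < Num.min e 1 by rewrite lt_min e0 ltr01.
have m1 : Num.min e 1 <= 1 by rewrite ge_min lexx orbT.
have : F [set y | ball l (Num.min e 1) y.1] by exact: (Fl _ m0).
apply: filterS2 Fb => y yb; rewrite /= ballEmdist/= => ly.
apply: (@le_ball _ _ _ (Num.min e 1)); first by rewrite ge_min lexx.
by apply/two_copies_ball.
Qed.

HB.instance Definition _ := Uniform_isComplete.Build (two_copies M)
  two_copies_cauchy.

Lemma two_copies_separable : separable M -> separable (two_copies M).
Proof.
move=> [D cD dD]; exists (D `*` [set: bool]); first exact: countableX.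
move=> O [[x b] Oxb] oO.
have /nbhs_ballP[e /= e0 eO] : nbhs ((x, b) : two_copies M) O.
  by apply: open_nbhs_nbhs; split.
have m0 : 0 < Num.min e 1 by rewrite lt_min e0 ltr01.
have m1 : Num.min e 1 <= 1 by rewrite ge_min lexx orbT.
have [y [xy Dy]] := dD (ball x (Num.min e 1)) (ex_intro _ x (ballxx x m0))
  (open_metric_ball _ _).
exists ((y, b) : two_copies M); split => //; apply: eO.
apply: (@le_ball _ _ _ (Num.min e 1)); first by rewrite ge_min lexx.
by apply/two_copies_ball => //; move: xy; rewrite ballEmdist.
Qed.

Lemma two_copies_fst_continuous : continuous (fst : two_copies M -> M).
Proof.
move=> x A /nbhs_ballP[e /= e0 eA].
have m0 : 0 < Num.min e 1 by rewrite lt_min e0 ltr01.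
have m1 : Num.min e 1 <= 1 by rewrite ge_min lexx orbT.
apply/nbhs_ballP; exists (Num.min e 1) => // y xy.
have [{}xy _] := (two_copies_ball x y m1).1 xy; apply: eA.
by rewrite ballEmdist/= (lt_le_trans xy)// ge_min lexx.
Qed.

Lemma two_copies_snd_open (b : bool) : open [set x : two_copies M | x.2 = b].
Proof.
rewrite openE => x /= xb; have := nbhsx_ballx x _ ltr01.
apply: filterS => y xy; have [_ xyE] := (two_copies_ball x y (lexx 1)).1 xy.
by rewrite /= -xyE.
Qed.

Lemma two_copies_pair_continuous (b : bool) :
  continuous (fun x : M => (x, b) : two_copies M).
Proof.
move=> x A /nbhs_ballP[e /= e0 eA].
have m0 : 0 < Num.min e 1 by rewrite lt_min e0 ltr01.
have m1 : Num.min e 1 <= 1 by rewrite ge_min lexx orbT.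
apply/nbhs_ballP; exists (Num.min e 1) => // y; rewrite ballEmdist/= => xy.
apply: eA; apply: (@le_ball _ _ _ (Num.min e 1)); first by rewrite ge_min lexx.
by apply/two_copies_ball.
Qed.

End two_copies.

Lemma continuous_measurable_borel (S T : ptopologicalType) (f : S -> T) :
  continuous f -> measurable_fun [set: borel S] (f : borel S -> borel T).
Proof.
move=> /continuousP cf.
apply: (@measurability _ _ _ (borel T) _ _ (@open T) erefl) => //.
move=> _ [A oA <-]; rewrite setTI; apply: sub_sigma_algebra.
exact: cf.
Qed.

(** All that the cone uses of the doubled space: the two inclusions, the
   projection and the name of the copy, with their measurability. *)
Lemma polish_doubling (R : realType) (X : polish_space R) :
  exists (Y : polish_space R) (j : bool -> bor X -> bor Y) (pr : bor Y -> bor X)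
      (flag : bor Y -> bool),
    [/\ forall b, measurable_fun [set: bor X] (j b),
        measurable_fun [set: bor Y] pr, measurable_fun [set: bor Y] flag,
        forall b x, pr (j b x) = x & forall b x, flag (j b x) = b].
Proof.
have [M sepM [h [g [hK gK ch cg]]]] := carrier_polish X.
pose D := PointedTopological.class (two_copies M : ptopologicalType).
have polD : polish R (PointedTopological.Pack D).
  exists (two_copies M); first exact: two_copies_separable.
  by exists id, id; split => //; move=> x; exact: cvg_id.
exists (PolishSpace polD), (fun b x => (h x, b)), (fun y => g y.1), snd; split.
- move=> b; apply: (@continuous_measurable_borel (topology_of X) (two_copies M)).
  move=> x; apply: (@continuous_comp _ _ _ h (fun x => (x, b) : two_copies M)).
    exact: ch.
  exact: two_copies_pair_continuous.
- apply: (@continuous_measurable_borel (two_copies M) (topology_of X)).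
  move=> x; apply: (@continuous_comp (two_copies M) M (topology_of X) fst g);
    last exact: cg.
  exact: two_copies_fst_continuous.
- apply: (measurable_fun_bool true); rewrite setTI; apply: sub_sigma_algebra.
  exact: two_copies_snd_open.
- by move=> b x; exact: hK.
- by [].
Qed.

(** * The cone over a network *)

Section product_marginals.
Context d d' (S : measurableType d) (T : measurableType d') (R : realType).
Variables (P : probability S R) (Q : probability T R).

Lemma is_pushforward_fst : is_pushforward fst (P \x Q)%E P.
Proof.
move=> A mA; rewrite /pushforward.
have -> : fst @^-1` A = A `*` [set: T].
  by apply/seteqP; split => [[x y]|[x y]] /=; tauto.
transitivity (P A * Q [set: T])%E; first exact: product_measure1E.
by rewrite probability_setT mule1.
Qed.

Lemma is_pushforward_snd : is_pushforward snd (P \x Q)%E Q.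
Proof.
move=> A mA; rewrite /pushforward.
have -> : snd @^-1` A = [set: S] `*` A.
  by apply/seteqP; split => [[x y]|[x y]] /=; tauto.
transitivity (P [set: S] * Q A)%E; first exact: product_measure1E.
by rewrite probability_setT mul1e.
Qed.

End product_marginals.

Section cone.
Context (R : realType) (Z : completeMetricType R) (p : R).
Hypotheses (separable_Z : separable Z) (p_ge1 : 1 <= p).
Implicit Types X Y : network Z p.

Local Notation unif := (uniform_prob (@ltr01 R)).
Local Notation RR := (measurableTypeR R).

(** A point of [X] with an independent uniform parameter. *)
Definition randomized X : probability (bor X * RR)%type R :=
  (law X \x unif)%E.

Lemma network_Lp X (z : Z) :
  (kernel_dist (law X) p (kernel X) (fun=> z) < +oo)%E.
Proof.
have [z0 fin] := weight_Lp X.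
have mcst (y : Z) : measurable_kernel Z (fun _ : bor X * bor X => y).
  exact: measurable_cst.
apply: (le_lt_trans (kernel_dist_triangle separable_Z p_ge1 (law X)
  (measurable_kernel_network X) (mcst z0) (mcst z))).
by rewrite kernel_dist_cst// lte_add_pinfty// ltry.
Qed.

(** The weight of the cone at level [t], pulled back to the randomized space: a
   point is still in the first copy at level [t] when its parameter is at
   least [t]. *)
Definition cut X (t : R) (u : (bor X * RR) * (bor X * RR)) : Z :=
  if (t <= u.1.2) && (t <= u.2.2) then kernel X (u.1.1, u.2.1) else point.

Lemma measurable_flag d (T : measurableType d) (f : T -> R) (t : R) :
  measurable_fun [set: T] f -> measurable_fun [set: T] (fun x => t <= f x).
Proof. by move=> mf; apply: measurable_fun_ler. Qed.

Lemma measurable_cut X t : measurable_kernel Z (@cut X t).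
Proof.
have mR : measurable_fun [set: bor X * RR] snd by exact: measurable_snd.
have mX : measurable_fun [set: bor X * RR] fst by exact: measurable_fst.
apply: measurable_fun_ifT; last exact: measurable_cst.
  by apply: measurable_and; apply: measurable_flag; apply: measurableT_comp.
exact: (measurable_pullback mX (measurable_kernel_network X)).
Qed.

(** The cone at level [t], up to weak isomorphism, is any network realized on the
   randomized space with the weight [cut X t]. *)
Definition is_cone X (t : R) Y := exists c : bor X * RR -> bor Y,
  [/\ measurable_fun [set: bor X * RR] c,
      is_pushforward c (randomized X) (law Y) &
      pullback c (kernel Y) = @cut X t].

Lemma cone_exists X (t : R) : exists Y, is_cone X t Y.
Proof.
have [Y [j [pr [flag [mj mpr mflag jK jflag]]]]] := polish_doubling X.
pose c : bor X * RR -> bor Y :=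
  fun u => if t <= u.2 then j true u.1 else j false u.1.
have mc : measurable_fun [set: bor X * RR] c.
  apply: measurable_fun_ifT; first exact: measurable_flag.
  - exact: (measurableT_comp (mj true)).
  - exact: (measurableT_comp (mj false)).
pose mu : probability (bor Y) R := distribution (randomized X) (HB.pack c
  (isMeasurableFun.Build _ _ _ _ _ mc) : {mfun (bor X * RR)%type >-> bor Y}).
pose w : bor Y * bor Y -> Z := fun y =>
  if flag y.1 && flag y.2 then kernel X (pr y.1, pr y.2) else point.
have mw : measurable_kernel Z w.
  apply: measurable_fun_ifT; last exact: measurable_cst.
    by apply: measurable_and; apply: measurableT_comp.
  exact: (measurable_pullback mpr (measurable_kernel_network X)).
have wc : pullback c w = @cut X t.
  apply/funext => -[[x a] [y b]]; rewrite /pullback /w /c /cut/=.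
  by case: (t <= a); case: (t <= b); rewrite !jflag ?jK.
have wLp : exists z0 : Z,
    (Lnorm (mu \x mu) p%:E (fun u => (mdist (w u) z0)%:E) < +oo)%E.
  exists point.
  have mcst : measurable_kernel Z (fun _ : bor Y * bor Y => point : Z).
    exact: measurable_cst.
  have -> : Lnorm (mu \x mu)%E p%:E (fun u => (mdist (w u) point)%:E) =
            kernel_dist (randomized X) p (@cut X t) (fun=> point).
    rewrite -wc.
    exact: (@kernel_dist_pushforward _ _ p separable_Z _ _ (randomized X) _ _
      mu c mc _ _ _ mw mcst).
  apply: le_lt_trans (network_Lp X point).
  rewrite (kernel_dist_pushforward p separable_Z measurable_fst
    (is_pushforward_fst (law X) unif) (measurable_kernel_network X));
    last exact: measurable_cst.
  apply: (le_kernel_dist separable_Z p_ge1); [exact: measurable_cut|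
    exact: measurable_cst| |exact: measurable_cst|].
    exact: (measurable_pullback measurable_fst (measurable_kernel_network X)).
  move=> [[x a] [y b]]; rewrite /cut /pullback/=.
  by case: ifP => // _; rewrite mdistxx mdist_ge0.
exists (@Network R Z p Y mu w mw wLp), c; split.
- exact: mc.
- by [].
- exact: wc.
Qed.

(** A coupling of [X] and [X'] together with one common parameter realizes both
   cones; where the weights are cut, they are cut simultaneously. *)
Lemma is_cone_le X X' t Y Y' : is_cone X t Y -> is_cone X' t Y' ->
  (GW Y Y' <= GW X X')%E.
Proof.
move=> [c [mc cY wc]] [c' [mc' cY' wc']].
rewrite leNgt; apply/negP => /GW_lt_coupling[P [PX PX']].
rewrite ltNge => /negP; apply.
pose T := ((bor X * bor X') * RR)%type.
pose q : T -> bor X * RR := pair_map (fst : bor X * bor X' -> bor X) (@idfun RR).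
pose q' : T -> bor X' * RR := pair_map (snd : bor X * bor X' -> bor X') (@idfun RR).
have mq : measurable_fun [set: (bor X * bor X') * RR] q.
  by apply: measurable_pair_map; [exact: measurable_fst|exact: measurable_id].
have mq' : measurable_fun [set: (bor X * bor X') * RR] q'.
  by apply: measurable_pair_map; [exact: measurable_snd|exact: measurable_id].
have qP : is_pushforward q (P \x unif)%E (randomized X).
  by apply: is_pushforward_product; [exact: measurable_fst|exact: measurable_id|
    exact: PX|].
have qP' : is_pushforward q' (P \x unif)%E (randomized X').
  by apply: is_pushforward_product; [exact: measurable_snd|exact: measurable_id|
    exact: PX'|].
apply: (le_trans (GW_le_realization separable_Z (measurableT_comp mc mq)
  (measurableT_comp mc' mq') (is_pushforward_comp mc qP cY)
  (is_pushforward_comp mc' qP' cY'))).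
rewrite lee_pmul2l ?lte_fin ?invr_gt0//.
have mX : measurable_kernel Z (pullback (fst : bor X * bor X' -> bor X) (kernel X)).
  exact: (measurable_pullback measurable_fst (measurable_kernel_network X)).
have mX' : measurable_kernel Z (pullback (snd : bor X * bor X' -> bor X') (kernel X')).
  exact: (measurable_pullback measurable_snd (measurable_kernel_network X')).
rewrite (kernel_dist_pushforward p separable_Z measurable_fst
  (is_pushforward_fst P unif) mX mX').
apply: (le_kernel_dist separable_Z p_ge1).
- exact: (measurable_pullback (measurableT_comp mc mq) (measurable_kernel_network Y)).
- exact: (measurable_pullback (measurableT_comp mc' mq') (measurable_kernel_network Y')).
- exact: (measurable_pullback measurable_fst mX).
- exact: (measurable_pullback measurable_fst mX').
move=> u; rewrite -[pullback (c \o q) _ u]/(pullback q (pullback c (kernel Y)) u).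
rewrite -[pullback (c' \o q') _ u]/(pullback q' (pullback c' (kernel Y')) u).
rewrite wc wc' /cut /pullback/=.
by case: ifP => // _; rewrite mdistxx mdist_ge0.
Qed.

Lemma uniform_le_lebesgue (A : set RR) : measurable A ->
  (unif A <= lebesgue_measure (A `&` `[0%R, 1%R]))%E.
Proof.
move=> mA; rewrite /uniform_prob integral_uniform_pdf.
have mAI : measurable (A `&` `[0, 1]%classic : set RR) by exact: measurableI.
rewrite -[leRHS]mul1e -integral_cst//; apply: ge0_le_integral => //.
- by move=> x _; rewrite lee_fin uniform_pdf_ge0.
- by apply/measurable_EFinP/measurable_funTS; exact: measurable_uniform_pdf.
- move=> x _; rewrite lee_fin /uniform_pdf subr0 invr1.
  by case: ifP.
Qed.

Lemma ae_is_pushforward d d' (S : measurableType d) (T : measurableType d')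
    (P : probability S R) (Q : probability T R) (f : S -> T) (A : T -> Prop) :
  measurable_fun [set: S] f -> is_pushforward f P Q ->
  {ae Q, forall t, A t} -> {ae P, forall s, A (f s)}.
Proof.
move=> mf fPQ [B [mB QB AB]]; exists (f @^-1` B); split.
- by rewrite -[_ @^-1` _]setTI; exact: mf.
- by rewrite -QB -(fPQ _ mB).
- by move=> s /= nAs; exact: AB.
Qed.

Lemma ae_randomized X (A : RR -> Prop) : {ae unif, forall a, A a} ->
  {ae (randomized X \x randomized X)%E, forall u, A u.1.2 /\ A u.2.2}.
Proof.
move=> aeA; apply: (@product_ae _ _ _ _ (fun v : bor X * RR => A v.2)).
exact: (ae_is_pushforward measurable_snd (is_pushforward_snd (law X) unif) aeA).
Qed.

Lemma is_cone0 X Y : is_cone X 0 Y -> GW X Y = 0%E.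
Proof.
move=> [c [mc cY wc]].
apply: (GW_eq0 separable_Z p_ge1 measurable_fst mc
  (is_pushforward_fst (law X) unif) cY).
rewrite wc; have : {ae unif, forall a : RR, 0 <= a}.
  exists `]-oo, 0[%classic; split => //=.
    apply/eqP; rewrite eq_le measure_ge0 andbT.
    apply: (le_trans (uniform_le_lebesgue (measurable_itv `]-oo, 0[))).
    rewrite (_ : _ `&` _ = set0) ?measure0//.
    apply/seteqP; split => // a [] /=; rewrite !in_itv/= => a0 /andP[].
    by rewrite leNgt a0.
  by move=> a /= /negP; rewrite -ltNge in_itv.
move=> /(@ae_randomized X) aeX; apply: filterS aeX => u [u1 u2].
by rewrite /cut u1 u2.
Qed.

(** The carrier may be any Polish space if the law is a Dirac mass; [Z] itself is
   at hand. A Dirac mass is the image of every probability under a constant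
   map. *)
Lemma point_network_exists : exists O : network Z p,
  (forall u, kernel O u = point) /\
  forall d (T : measurableType d) (P : probability T R),
    exists2 b : T -> bor O, measurable_fun [set: T] b &
      is_pushforward b P (law O).
Proof.
pose D := PointedTopological.class (Z : ptopologicalType).
have polD : polish R (PointedTopological.Pack D).
  exists Z => //; exists id, id; split => //; move=> x; exact: cvg_id.
pose X := PolishSpace polD; pose o : bor X := point.
have mw : measurable_fun [set: bor X * bor X]
    ((fun=> point) : bor X * bor X -> borel Z) by exact: measurable_cst.
have wLp : exists z0 : Z, (Lnorm (\d_o \x \d_o) p%:E
    (fun u : bor X * bor X => (mdist (point : Z) z0)%:E) < +oo)%E.
  exists point.
  rewrite -[Lnorm _ _ _]/(kernel_dist \d_o p (fun=> point) (fun=> point)).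
  by rewrite kernel_dist_cst// ltry.
exists (@Network R Z p X \d_o (fun=> point) mw wLp); split => // d T P.
exists (fun=> o); first exact: measurable_cst.
move=> A mA; rewrite /pushforward/= diracE.
have [oA|oA] := boolP (o \in A).
  rewrite (_ : _ @^-1` _ = [set: T]) ?probability_setT//.
  by apply/seteqP; split => // t _; exact: set_mem.
rewrite (_ : _ @^-1` _ = set0) ?measure0//.
by apply/seteqP; split => // t /= /mem_set; apply/negP.
Qed.

Lemma is_cone1 X Y O : is_cone X 1 Y -> (forall u, kernel O u = point) ->
  (exists2 b : bor X * RR -> bor O, measurable_fun [set: bor X * RR] b &
     is_pushforward b (randomized X) (law O)) -> GW Y O = 0%E.
Proof.
move=> [c [mc cY wc]] wO [b mb bO].
apply: (GW_eq0 separable_Z p_ge1 mc mb cY bO).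
rewrite wc; have : {ae unif, forall a : RR, a < 1}.
  exists `[1, +oo[%classic; split => //=.
    apply/eqP; rewrite eq_le measure_ge0 andbT.
    apply: (le_trans (uniform_le_lebesgue (measurable_itv `[1, +oo[))).
    rewrite (_ : _ `&` _ = [set 1]) ?lebesgue_measure_set1//.
    apply/seteqP; split => [a []|a ->] /=; rewrite !in_itv/=; last first.
      by rewrite lexx ler01.
    by rewrite andbT => a1 /andP[_ a1']; apply/eqP; rewrite eq_le a1 a1'.
  by move=> a /= /negP; rewrite -leNgt in_itv/= andbT.
move=> /(@ae_randomized X) aeX; apply: filterS aeX => u [u1 u2].
by rewrite /cut /pullback wO leNgt u1.
Qed.

Lemma uniform_itv_le (t r : R) : 0 < r ->
  (unif `[(t - r)%R, (t + r)%R]%classic <= (r + r)%:E)%E.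
Proof.
move=> r0; apply: (le_trans (uniform_le_lebesgue (measurable_itv _))).
apply: (@le_trans _ _ (lebesgue_measure (`[t - r, t + r]%classic : set RR))).
  by apply: le_measure; rewrite ?inE//; exact: measurableI.
rewrite lebesgue_measure_itv/= lte_fin; case: ifP => _.
  by rewrite -EFinB lee_fin; lra.
by rewrite lee_fin addr_ge0// ltW.
Qed.

(** With the same point and the same parameter, the weights at levels [t] and [s]
   differ only if one of the two parameters is within [`|s - t|] of [t]; the
   difference is then at most the distance of the weight of [X] to [point]. *)
Lemma is_cone_continuous X (t e : R) : 0 < e ->
  exists2 r : R, 0 < r & forall s Y Y', `|s - t| < r ->
    is_cone X t Y -> is_cone X s Y' -> (GW Y Y' <= e%:E)%E.
Proof.
move=> e0.
pose P := randomized X; pose T := (bor X * RR)%type.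
have mcst : measurable_kernel Z (fun _ : T * T => point : Z).
  exact: measurable_cst.
have mX : measurable_kernel Z (pullback (fst : T -> bor X) (kernel X)).
  exact: (measurable_pullback measurable_fst (measurable_kernel_network X)).
have mf := measurable_fun_mdist separable_Z mX mcst.
set f := (fun u => mdist _ _) in mf.
have f_fin : (Lnorm (P \x P) p%:E (EFin \o f) < +oo)%E.
  have := network_Lp X point.
  rewrite (kernel_dist_pushforward p separable_Z measurable_fst
    (is_pushforward_fst (law X) unif) (measurable_kernel_network X)).
    exact: id.
  exact: measurable_cst.
have [r r0 rP] := Lnorm_indic_small p_ge1 mf f_fin e0.
(* [I] has uniform measure at most [r / 4], and [B] measure at most [r / 2]. *)
pose I := `[t - r / 8, t + r / 8]%classic : set RR.
have mI : measurable I by exact: measurable_itv.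
pose S := [set: bor X] `*` I : set T.
have mS : measurable S by exact: measurableX.
pose B := (S `*` [set: T]) `|` ([set: T] `*` S).
have mST : measurable (S `*` [set: T]) by exact: measurableX.
have mTS : measurable ([set: T] `*` S) by exact: measurableX.
have mB : measurable B by exact: measurableU.
have PS : (P S <= (r / 8 + r / 8)%:E)%E.
  apply: le_trans (uniform_itv_le t (divr_gt0 r0 _)) => //.
  rewrite le_eqVlt; apply/orP; left; apply/eqP.
  rewrite -(is_pushforward_snd (law X) unif mI); congr (P _).
  by apply/seteqP; split => -[x y]; rewrite /S /preimage/=; tauto.
have PB : ((P \x P) B < r%:E)%E.
  apply: (@le_lt_trans _ _ (P S + P S)%E); last first.
    by apply: (le_lt_trans (leeD PS PS)); rewrite -EFinD lte_fin; lra.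
  apply: (le_trans (@measureU2 _ _ _ (P \x P)%E _ _ mST mTS)).
  apply: leeD; rewrite le_eqVlt; apply/orP; left; apply/eqP.
    rewrite -(is_pushforward_fst P P mS); congr ((P \x P)%E _).
    by apply/seteqP; split => [[x y]|[x y]] /=; tauto.
  rewrite -(is_pushforward_snd P P mS); congr ((P \x P)%E _).
  by apply/seteqP; split => [[x y]|[x y]] /=; tauto.
have {rP} := rP B mB PB.
set g := (fun x => _) => gP.
exists (r / 8); first by rewrite divr_gt0.
move=> s Y Y' st [c [mc cY wc]] [c' [mc' cY' wc']].
apply: (le_trans (GW_le_realization separable_Z mc mc' cY cY')).
rewrite wc wc'.
apply: (@le_trans _ _ (2^-1%:E * e%:E)%E); last by rewrite -EFinM lee_fin; lra.
rewrite lee_pmul2l ?lte_fin ?invr_gt0//; apply: le_trans gP.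
apply: le_Lnorm => //.
- by apply: (measurable_fun_mdist separable_Z); exact: measurable_cut.
- by apply: measurable_funM => //; exact: measurable_indic.
have inI a : (t <= a) != (s <= a) -> I a.
  move=> H; rewrite /I/= in_itv/=; move: st H; rewrite ltr_norml => /andP[st1 st2].
  by case: (leP t a) => ta; case: (leP s a) => sa// _; apply/andP; split; lra.
move=> [[x a] [y b]]; rewrite ger0_norm ?mdist_ge0//.
rewrite /g ger0_norm ?mulr_ge0 ?mdist_ge0 ?indicE//.
have [ta|/inI Ia] := eqVneq (t <= a) (s <= a); last first.
  rewrite mem_set ?mul1r; last by left.
  rewrite /f /cut /pullback/=.
  by do 2![case: ifP => _]; rewrite ?mdistxx ?mdist_ge0// metric_sym.
have [tb|/inI Ib] := eqVneq (t <= b) (s <= b); last first.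
  rewrite mem_set ?mul1r; last by right.
  rewrite /f /cut /pullback/=.
  by do 2![case: ifP => _]; rewrite ?mdistxx ?mdist_ge0// metric_sym.
by rewrite /cut/= ta tb mdistxx mulr_ge0 ?mdist_ge0.
Qed.

End cone.

(** * The contraction of the space of classes *)

Section classes.
Context (R : realType) (Z : completeMetricType R) (p : R).
Hypotheses (separable_Z : separable Z) (p_ge1 : 1 <= p).
Implicit Types (X Y : network Z p) (C D : network_classes Z p).

Definition class_of X : network_classes Z p :=
  exist _ [set Y | weakly_isomorphic X Y] (ex_intro _ X erefl).

Lemma GW_representative X : GW X (representative (class_of X)) = 0%E.
Proof.
apply: (weakly_isomorphic_GW separable_Z p_ge1).
rewrite /representative; case: cid => X0 /= X0E.
suff : [set Y | weakly_isomorphic X Y] X0 by [].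
by rewrite X0E; exact: weakly_isomorphic_refl.
Qed.

Lemma GW_refl X : GW X X = 0%E.
Proof.
exact: (weakly_isomorphic_GW separable_Z p_ge1 (weakly_isomorphic_refl X)).
Qed.

Lemma GW_eq0_trans X Y X' : GW X Y = 0%E -> GW Y X' = 0%E -> GW X X' = 0%E.
Proof.
move=> XY YX'; apply/eqP; rewrite eq_le GW_ge0 andbT.
by rewrite (le_trans (GW_triangle separable_Z p_ge1 X Y X'))// XY YX' adde0.
Qed.

(** By the triangle inequality the ball is open. *)
Lemma GW_ball_nbhs C (e : R) : 0 < e ->
  nbhs C [set D | (GW_classes C D < e%:E)%E].
Proof.
move=> e0; apply: open_nbhs_nbhs; split; last first.
  by rewrite /= /GW_classes GW_refl lte_fin.
move=> D /= CDe.
have fCD : GW_classes C D \is a fin_num.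
  by rewrite ge0_fin_numE ?GW_ge0// (lt_trans CDe)// ltry.
exists (e - fine (GW_classes C D)).
  by rewrite subr_gt0 -lte_fin fineK.
move=> E /= DE; apply: (le_lt_trans
  (GW_triangle separable_Z p_ge1 _ (representative D) _)).
have -> : e%:E = (GW_classes C D + (e - fine (GW_classes C D))%:E)%E.
  by rewrite -{1}(fineK fCD) -EFinD subrKC.
by rewrite lteD2lE.
Qed.

Lemma nbhs_GW_ball C (U : set (network_classes Z p)) : nbhs C U ->
  exists2 e : R, 0 < e & [set D | (GW_classes C D < e%:E)%E] `<=` U.
Proof.
rewrite nbhsE => -[V [oV VC] VU]; have [e e0 eV] := oV C VC.
by exists e => //; apply: subset_trans VU.
Qed.

Definition cone X (t : R) : network Z p :=
  sval (cid (cone_exists separable_Z p_ge1 X t)).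

Lemma coneP X t : is_cone X t (cone X t).
Proof. exact: svalP (cid (cone_exists separable_Z p_ge1 X t)). Qed.

Definition apex : network Z p :=
  sval (cid (point_network_exists separable_Z p_ge1)).

(** At level [0] the class itself is taken, so that the contraction starts at the
   identity on the nose and not only up to distance [0]; likewise at level [1]. *)
Definition contraction (u : network_classes Z p * R) : network_classes Z p :=
  if u.2 == 0 then u.1 else if u.2 == 1 then class_of apex
  else class_of (cone (representative u.1) u.2).

(** In terms of [GW], the three cases of the definition are all the cone. *)
Lemma GW_contraction_cone C t :
  GW (representative (contraction (C, t))) (cone (representative C) t) = 0%E.
Proof.
rewrite /contraction/=; have [->|_] := eqVneq t 0.
  exact: (is_cone0 separable_Z p_ge1 (coneP _ _)).
have [->|_] := eqVneq t 1; last by rewrite GW_sym//; exact: GW_representative.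
apply: (@GW_eq0_trans _ apex); rewrite GW_sym//; first exact: GW_representative.
have [apexE apex_law] := svalP (cid (point_network_exists separable_Z p_ge1)).
exact: (is_cone1 separable_Z p_ge1 (coneP _ _) apexE (apex_law _ _ _)).
Qed.

Lemma contraction_continuous : continuous contraction.
Proof.
move=> [C t] U /nbhs_GW_ball[e e0 eU].
have e30 : 0 < e / 3 by rewrite divr_gt0.
have [r r0 rP] := is_cone_continuous separable_Z p_ge1 (representative C) t e30.
exists ([set D | (GW_classes C D < (e / 3)%:E)%E], ball t r) => /=.
  by split; [exact: GW_ball_nbhs|exact: nbhsx_ballx].
move=> [D s] /= [CD]; rewrite /ball/= distrC => st; apply: eU => /=.
have tri := GW_triangle separable_Z p_ge1.
rewrite /GW_classes.
apply: (le_lt_trans (tri _ (cone (representative C) t) _)).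
rewrite GW_contraction_cone add0e.
apply: (le_lt_trans (tri _ (cone (representative D) s) _)).
rewrite [X in (_ + X)%E]GW_sym// GW_contraction_cone adde0.
apply: (le_lt_trans (tri _ (cone (representative C) s) _)).
apply: (@le_lt_trans _ _ ((e / 3)%:E + (e / 3)%:E)%E).
  apply: leeD; first exact: rP st (coneP _ _) (coneP _ _).
  exact: le_trans (is_cone_le separable_Z p_ge1 (coneP _ _) (coneP _ _)) (ltW CD).
by rewrite -EFinD lte_fin; lra.
Qed.

End classes.

Theorem theorem42 (R : realType) (Z : completeMetricType R) (p : R)
    (separable_Z : separable Z) (p_ge1 : 1 <= p) :
  contractible R (network_classes Z p).
Proof.
exists (class_of (apex separable_Z p_ge1)), (contraction separable_Z p_ge1); split.
- by apply: continuous_subspaceT; exact: contraction_continuous.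
- by move=> C; rewrite /contraction/= eqxx.
- by move=> C; rewrite /contraction/= oner_eq0 eqxx.
Qed.
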